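(* Let $G$ be a unipotent algebraic group over $\mathbb{C}$ and let $J$ be a Hopf $2$-cocycle for $G$ with support $H\subset G$. Then every irreducible representation $V$ of the algebra ${}_J\mathcal{O}(G)_J$ factors through the quotient ${}_J\mathcal{O}(Z)_J$ for a unique double coset $Z\in H\backslash G/H$.
   Context: For an affine algebraic group $G$ over $\mathbb{C}$, $\mathcal{O}(G)$ is its coordinate Hopf algebra, with Sweedler notation $\Delta(a)=\sum a_1\otimes a_2$ and counit $\varepsilon$. A Hopf $2$-cocycle for $G$ is a linear form $J:\mathcal{O}(G)\otimes\mathcal{O}(G)\to\mathbb{C}$ that has an inverse $J^{-1}$ for the convolution product $(f*h)(a,b)=\sum f(a_1,b_1)h(a_2,b_2)$ and satisfies $\sum J(a_1b_1,c)J(a_2,b_2)=\sum J(a,b_1c_1)J(b_2,c_2)$ and $J(a,1)=\varepsilon(a)=J(1,a)$ for all $a,b,c$. The Hopf algebra ${}_J\mathcal{O}(G)_J$ equals $\mathcal{O}(G)$ as a coalgebra and has multiplication $a\otimes b\mapsto \sum J^{-1}(a_1,b_1)\,a_2b_2\,J(a_3,b_3)$. Put $R^J:=J_{21}^{-1}*J$, where $J_{21}(a,b)=J(b,a)$; a Hopf $2$-cocycle $J$ for a group $H$ is minimal if $R^J$ is non-degenerate on $\mathcal{O}(H)$. The support of $J$ is the closed subgroup $H\subset G$ such that $J$ is (the pullback along the restriction map $\mathcal{O}(G)\to\mathcal{O}(H)$ of) a minimal Hopf $2$-cocycle for $H$. For a double coset $Z=HgH$, a closed subset of $G$, $\mathcal{I}(Z)\subset\mathcal{O}(G)$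 is its vanishing ideal (which is a two-sided ideal of ${}_J\mathcal{O}(G)_J$), and ${}_J\mathcal{O}(Z)_J:={}_J\mathcal{O}(G)_J/\mathcal{I}(Z)$. Irreducible representations are not assumed finite dimensional. *)

(* Defs.v *)
From HB Require Import structures.
From mathcomp Require Import all_boot all_order all_algebra.
From mathcomp Require Import mathcomp_extra boolp classical_sets functions reals.
From mathcomp Require Import complex mpoly.

Set Implicit Arguments.
Unset Strict Implicit.
Unset Printing Implicit Defensive.

Import GRing.Theory.
Local Open Scope classical_set_scope.
Local Open Scope ring_scope.

Definition zariski_closed (k : closedFieldType) n (X : set ('I_n -> k)) : Prop :=
  exists S : set {mpoly k[n]}, X = [set x | forall p, S p -> p.@[x] = 0].

Definition glue (k : Type) m n (x : 'I_m -> k) (y : 'I_n -> k) (i : 'I_(m + n)) : k :=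
  match fintype.split i with inl j => x j | inr j => y j end.

(* An affine variety over an algebraically closed field is identified with its
   set of points: a Zariski closed subset of some affine space. *)
Record affGroup (k : closedFieldType) := AffGroup {
  points :> groupType;
  adim : nat;
  coordf : points -> 'I_adim -> k;
  coordf_inj : injective coordf;
  coordf_closed : zariski_closed (range coordf);
  coordf_mul : forall i, exists p : {mpoly k[adim + adim]},
    forall g h, coordf (g * h)%g i = p.@[glue (coordf g) (coordf h)];
  coordf_inv : forall i, exists p : {mpoly k[adim]},
    forall g, coordf (g^-1)%g i = p.@[coordf g]
}.

Section CoordinateAlgebra.
Variables (k : closedFieldType) (G : affGroup k).

Definition regular : {pred (G -> k)} :=
  fun f => `[< exists p : {mpoly k[adim G]}, forall g, f g = p.@[coordf g] >].

Lemma regularP f : reflect (exists p : {mpoly k[adim G]}, forall g, f g = p.@[coordf g]) (f \in regular).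
Proof. exact: asboolP. Qed.

(* O(G) *)
Record coordAlg := CoordAlg { regfun :> G -> k; _ : regfun \in regular }.

HB.instance Definition _ := [isSub for regfun].
HB.instance Definition _ := [Choice of coordAlg by <:].

Lemma regular_subring : GRing.subring_closed regular.
Proof.
split=> [|f g|f g]; first by apply/regularP; exists 1 => g; rewrite rmorph1.
- move=> /regularP[p fp] /regularP[q gq]; apply/regularP; exists (p - q) => x.
  by rewrite rmorphB /= -fp -gq.
- move=> /regularP[p fp] /regularP[q gq]; apply/regularP; exists (p * q) => x.
  by rewrite rmorphM /= -fp -gq.
Qed.

HB.instance Definition _ :=
  GRing.SubChoice_isSubComPzRing.Build (G -> k) regular coordAlg regular_subring.

Lemma coordAlg_eqP (a b : coordAlg) : (forall g, a g = b g) -> a = b.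
Proof. by move=> ab; apply/val_inj/funext. Qed.

Lemma oneE g : (1 : coordAlg) g = 1. Proof. by []. Qed.
Lemma addE (a b : coordAlg) g : (a + b) g = a g + b g. Proof. by []. Qed.
Lemma mulE (a b : coordAlg) g : (a * b) g = a g * b g. Proof. by []. Qed.
Lemma subE (a b : coordAlg) g : (a - b) g = a g - b g. Proof. by []. Qed.
Lemma zeroE g : (0 : coordAlg) g = 0. Proof. by []. Qed.

Lemma coordAlg_neq0 : 1 != 0 :> coordAlg.
Proof.
apply/eqP => /(congr1 (fun a : coordAlg => a 1%g)).
by rewrite oneE zeroE => /eqP; rewrite oner_eq0.
Qed.

HB.instance Definition _ := GRing.PzSemiRing_isNonZero.Build coordAlg coordAlg_neq0.


Fact scale_regular (c : k) (a : coordAlg) : (fun g => c * a g) \in regular.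
Proof.
have /regularP[p ap] := valP a; apply/regularP; exists (c *: p) => g /=.
by rewrite mevalZ -ap.
Qed.
Definition coordAlg_scale c a := CoordAlg (scale_regular c a).

Fact coordAlg_scaleA c d a :
  coordAlg_scale c (coordAlg_scale d a) = coordAlg_scale (c * d) a.
Proof. by apply: coordAlg_eqP => g; rewrite /regfun /= mulrA. Qed.
Fact coordAlg_scale1 : left_id 1 coordAlg_scale.
Proof. by move=> a; apply: coordAlg_eqP => g; rewrite /regfun /= mul1r. Qed.
Fact coordAlg_scaleDr : right_distributive coordAlg_scale +%R.
Proof. by move=> c a b; apply: coordAlg_eqP => g; rewrite /regfun /= mulrDr. Qed.
Fact coordAlg_scaleDl a : {morph coordAlg_scale^~ a : c d / c + d}.
Proof. by move=> c d; apply: coordAlg_eqP => g; rewrite /regfun /= mulrDl. Qed.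

HB.instance Definition _ := GRing.Zmodule_isLmodule.Build k coordAlg
  coordAlg_scaleA coordAlg_scale1 coordAlg_scaleDr coordAlg_scaleDl.

Lemma scaleE c (a : coordAlg) g : (c *: a) g = c * a g. Proof. by []. Qed.

Fact coordAlg_scaleAl c (a b : coordAlg) : c *: (a * b) = (c *: a) * b.
Proof. by apply: coordAlg_eqP => g; rewrite !(mulE, scaleE) mulrA. Qed.
HB.instance Definition _ := GRing.Lmodule_isLalgebra.Build k coordAlg coordAlg_scaleAl.
HB.instance Definition _ := GRing.Lalgebra_isComAlgebra.Build k coordAlg.

Lemma sumE I (r : seq I) (P : pred I) (F : I -> coordAlg) g :
  (\sum_(i <- r | P i) F i) g = \sum_(i <- r | P i) F i g.
Proof. by elim/big_rec2: _ => // i y x _ <-. Qed.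

Definition counit (a : coordAlg) : k := a 1%g.

End CoordinateAlgebra.
Arguments regfun {k G} _ _ : simpl never.
Arguments coordAlg_scale : simpl never.

Section Scalar.
Variables (k : pzRingType) (A : lmodType k) (f : A -> k).
Hypothesis lf : scalar f.
Lemma scalar0 : f 0 = 0.
Proof. by have := lf (-1) 0 0; rewrite scaler0 addr0 mulN1r addNr. Qed.
Lemma scalarD x y : f (x + y) = f x + f y.
Proof. by have := lf 1 x y; rewrite scale1r mul1r. Qed.
Lemma scalarZ c x : f (c *: x) = c * f x.
Proof. by have := lf c x 0; rewrite !addr0 scalar0 addr0. Qed.
Lemma scalarB x y : f (x - y) = f x - f y.
Proof. by rewrite -scaleN1r scalarD scalarZ mulN1r. Qed.
Lemma scalar_sum I (r : seq I) (F : I -> A) : f (\sum_(i <- r) F i) = \sum_(i <- r) f (F i).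
Proof. by elim/big_rec2: _ => [|i y x _ <-]; [exact: scalar0 | exact: scalarD]. Qed.
End Scalar.

Definition bilinear_form (k : pzRingType) (A B : lmodType k) (f : A -> B -> k) : Prop :=
  (forall b, scalar (f^~ b)) /\ (forall a, scalar (f a)).

Section Tensor.
Variables (k : closedFieldType).

Lemma tensor_gen (G : affGroup k) (E X : Type) (ev : E -> X -> k)
    (beta : E -> coordAlg G -> k) :
    (forall e, scalar (beta e)) ->
    (forall s : seq (k * E), (forall x, \sum_(u <- s) u.1 * ev u.2 x = 0) ->
       forall r, \sum_(u <- s) u.1 * beta u.2 r = 0) ->
  forall s : seq (E * coordAlg G),
    (forall x l, \sum_(u <- s) ev u.1 x * u.2 l = 0) ->
    \sum_(u <- s) beta u.1 u.2 = 0.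
Proof.
move=> lb cb s; have [n] := ubnP (size s); elim: n s => // n IHn [|[e r] s] /=.
  by rewrite big_nil.
rewrite ltnS => sn; have [->|r0] := eqVneq r 0 => s0.
  rewrite big_cons /= scalar0 // add0r; apply: IHn => // x l.
  by have := s0 x l; rewrite big_cons /= mulr0 add0r.
have [l0 rl0] : exists l, r l != 0.
  apply: contrapT => /forallNP nr; move/eqP: r0; apply.
  by apply: coordAlg_eqP => g; apply/eqP; apply: contrapT; move/negP; exact: nr.
pose c (u : E * coordAlg G) := u.2 l0 / r l0.
have es x : ev e x = - \sum_(u <- s) c u * ev u.1 x.
  have := s0 x l0; rewrite big_cons /= => /eqP; rewrite addr_eq0 => /eqP h.
  apply: (mulIf rl0); rewrite h mulNr mulr_suml; congr (- _).
  by apply: eq_bigr => u _; rewrite /c mulrAC divfK // mulrC.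
have := cb ((1, e) :: [seq (c u, u.1) | u <- s]).
rewrite big_cons /= => /(_ _ r); rewrite big_cons !mul1r /= !big_map => be.
have {}be : beta e r = - \sum_(u <- s) c u * beta u.1 r.
  apply/eqP; rewrite -addr_eq0; apply/eqP; apply: be => x.
  by rewrite big_cons big_map /= mul1r es addNr.
have : \sum_(u <- [seq (u.1, u.2 - c u *: r) | u <- s]) beta u.1 u.2 = 0.
  apply: IHn; first by rewrite size_map.
  move=> x l; rewrite big_map /=; have := s0 x l; rewrite big_cons /= es => h.
  rewrite -[RHS]h mulNr mulr_suml addrC -sumrB; apply: eq_bigr => u _.
  rewrite subE scaleE mulrBr.
  by rewrite mulrCA mulrA.
rewrite big_map /= be => h; rewrite addrC -sumrB -[RHS]h.
by apply: eq_bigr => u _; rewrite scalarB // scalarZ.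
Qed.
End Tensor.

Section TensorForms.
Variable (k : closedFieldType).

Lemma tensor0 (G1 G2 : affGroup k) (B : coordAlg G1 -> coordAlg G2 -> k) :
  bilinear_form B -> forall s : seq (coordAlg G1 * coordAlg G2),
    (forall g h, \sum_(u <- s) u.1 g * u.2 h = 0) -> \sum_(u <- s) B u.1 u.2 = 0.
Proof.
move=> [Bl Br]; apply: tensor_gen => // s s0 r.
have : \sum_(u <- s) u.1 *: u.2 = 0.
  by apply: coordAlg_eqP => g; rewrite sumE zeroE -[RHS](s0 g).
move=> /(congr1 (B^~ r)) /=; rewrite (scalar0 (Bl r)) (scalar_sum (Bl r)) => h; rewrite -[RHS]h.
by apply: eq_bigr => u _; rewrite (scalarZ (Bl r)).
Qed.

Lemma tensor_eq (G1 G2 : affGroup k) (B : coordAlg G1 -> coordAlg G2 -> k) :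
  bilinear_form B -> forall s t : seq (coordAlg G1 * coordAlg G2),
    (forall g h, \sum_(u <- s) u.1 g * u.2 h = \sum_(u <- t) u.1 g * u.2 h) ->
  \sum_(u <- s) B u.1 u.2 = \sum_(u <- t) B u.1 u.2.
Proof.
move=> bB s t st; apply/eqP; rewrite -subr_eq0; apply/eqP.
have := @tensor0 _ _ B bB (s ++ [seq (- u.1, u.2) | u <- t]).
rewrite big_cat big_map /= => h; rewrite -[RHS]h {h}.
  rewrite -sumrN; congr (_ + _); apply: eq_bigr => u _.
  by rewrite -scaleN1r (scalarZ (bB.1 _)) mulN1r.
move=> g h; rewrite big_cat big_map /= st; apply/eqP; rewrite addr_eq0 -sumrN.
by apply/eqP; apply: eq_bigr => u _; rewrite -[- u.1]scaleN1r scaleE mulN1r mulNr opprK.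
Qed.

Definition trilinear_form (G : affGroup k) (T : coordAlg G -> coordAlg G -> coordAlg G -> k) :=
  [/\ forall b c, scalar (fun a => T a b c), forall a c, scalar (fun b => T a b c)
    & forall a b, scalar (T a b)].

Lemma tensor3_eq (G : affGroup k) (T : coordAlg G -> coordAlg G -> coordAlg G -> k) :
  trilinear_form T -> forall s t : seq (seq (coordAlg G * coordAlg G) * coordAlg G),
    (forall g h l, \sum_(w <- s) (\sum_(u <- w.1) u.1 g * u.2 h) * w.2 l =
                   \sum_(w <- t) (\sum_(u <- w.1) u.1 g * u.2 h) * w.2 l) ->
  \sum_(w <- s) \sum_(u <- w.1) T u.1 u.2 w.2 = \sum_(w <- t) \sum_(u <- w.1) T u.1 u.2 w.2.
Proof.
move=> [T1 T2 T3] s t st.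
pose ev (e : seq (coordAlg G * coordAlg G)) (x : G * G) := \sum_(u <- e) u.1 x.1 * u.2 x.2.
pose beta (e : seq (coordAlg G * coordAlg G)) (r : coordAlg G) := \sum_(u <- e) T u.1 u.2 r.
have lb e : scalar (beta e).
  move=> c x y; rewrite /beta mulr_sumr -big_split /=; apply: eq_bigr => u _.
  by rewrite T3.
apply/eqP; rewrite -subr_eq0; apply/eqP.
have := @tensor_gen k G _ _ ev beta lb _ (s ++ [seq (u.1, - u.2) | u <- t]).
rewrite big_cat big_map /= => h; rewrite -[RHS]h {h}.
- rewrite -sumrN; congr (_ + _); apply: eq_bigr => u _.
  by rewrite -[- u.2]scaleN1r (scalarZ (lb _)) mulN1r.
- move=> z z0 r.
  have := @tensor0 G G (fun a b => T a b r) (conj (T1^~ r) (T2^~ r))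
    (flatten [seq [seq (w.1 *: u.1, u.2) | u <- w.2] | w <- z]).
  rewrite big_flatten /= big_map => h; rewrite -[RHS]h.
    apply: eq_bigr => w _; rewrite big_map mulr_sumr; apply: eq_bigr => u _ /=.
    by rewrite (scalarZ (T1 _ _)).
  move=> g h'; rewrite big_flatten /= big_map -[RHS](z0 (g, h')).
  apply: eq_bigr => w _; rewrite big_map /ev mulr_sumr; apply: eq_bigr => u _ /=.
  by rewrite scaleE mulrA.
- move=> [g h] l; rewrite big_cat big_map /= [X in X + _]st; apply/eqP.
  rewrite addr_eq0 -sumrN; apply/eqP; apply: eq_bigr => u _.
  by rewrite -[- u.2]scaleN1r scaleE mulN1r mulrN opprK.
Qed.
End TensorForms.

Section Comultiplication.
Variables (k : closedFieldType) (G : affGroup k).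
Implicit Types a b c : coordAlg G.

Fact coordf_regular i : (fun g => coordf g i) \in @regular k G.
Proof. by apply/regularP; exists 'X_i => g; rewrite mevalXU. Qed.

Let split2 (F : G -> G -> k) := exists s : seq (coordAlg G * coordAlg G),
  forall g h, F g h = \sum_(u <- s) u.1 g * u.2 h.

Let split2D F F' : split2 F -> split2 F' -> split2 (fun g h => F g h + F' g h).
Proof.
by move=> [s Fs] [t Ft]; exists (s ++ t) => g h; rewrite big_cat Fs Ft.
Qed.

Let split2M F F' : split2 F -> split2 F' -> split2 (fun g h => F g h * F' g h).
Proof.
move=> [s Fs] [t Ft]; exists [seq (u.1 * v.1, u.2 * v.2) | u <- s, v <- t] => g h.
rewrite big_allpairs_dep Fs Ft mulr_suml; apply: eq_bigr => u _.
by rewrite mulr_sumr; apply: eq_bigr => v _; rewrite !mulE mulrACA.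
Qed.

Let split2C x : split2 (fun _ _ => x).
Proof. by exists [:: (x *: 1, 1)] => g h; rewrite big_seq1 scaleE !oneE !mulr1. Qed.

Let split2_poly n (p : {mpoly k[n]}) (v : G -> G -> 'I_n -> k) :
  (forall i, split2 (fun g h => v g h i)) -> split2 (fun g h => p.@[v g h]).
Proof.
move=> vs; have [s ps] : split2 (fun g h => \sum_(m <- msupp p) p@_m * \prod_(i < n) v g h i ^+ m i).
  elim: (msupp p) => [|m r IHr].
    by have [s sE] := split2C 0; exists s => g h; rewrite big_nil -sE.
  have [s sE] : split2 (fun g h => p@_m * \prod_(i < n) v g h i ^+ m i
     + \sum_(m <- r) p@_m * \prod_(i < n) v g h i ^+ m i).
    apply: split2D => //; apply: split2M; first exact: split2C.
    elim: (index_enum _) => [|i t IHt].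
      by have [s sE] := split2C 1; exists s => g h; rewrite big_nil -sE.
    have [s sE] : split2 (fun g h => v g h i ^+ m i * \prod_(i <- t) v g h i ^+ m i).
      apply: split2M => //; elim: (m i) => [|d IHd]; first exact: split2C.
      have [s sE] := split2M (vs i) IHd; exists s => g h.
      by rewrite exprS -sE.
    by exists s => g h; rewrite big_cons -sE.
  by exists s => g h; rewrite big_cons -sE.
by exists s => g h; rewrite mevalE -ps.
Qed.

Fact comul_subproof a : exists s : seq (coordAlg G * coordAlg G),
  forall g h, a (g * h)%g = \sum_(u <- s) u.1 g * u.2 h.
Proof.
have /regularP[p ap] := valP a.
have [|s sE] := @split2_poly _ p (fun g h => coordf (g * h)%g); last first.
  by exists s => g h; rewrite -sE -ap.
move=> i; have [q qE] := coordf_mul i.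
have [|s sE] := @split2_poly _ q (fun g h => glue (coordf g) (coordf h)); last first.
  by exists s => g h; rewrite qE -sE.
move=> j; rewrite /glue; case: fintype.split => j'.
  by exists [:: (CoordAlg (coordf_regular j'), 1)] => g h; rewrite big_seq1 oneE mulr1.
by exists [:: (1, CoordAlg (coordf_regular j'))] => g h; rewrite big_seq1 oneE mul1r.
Qed.

(* [comul a] lists the terms a_1 (x) a_2 of one decomposition of Delta(a), the
   regular function (g, h) |-> a (g h) on G x G under O(G x G) = O(G) (x) O(G).
   By tensor_eq, sums of values of a bilinear form over [comul a] do not depend
   on the decomposition. *)
Definition comul a : seq (coordAlg G * coordAlg G) := sval (cid (comul_subproof a)).

Lemma comulE a g h : a (g * h)%g = \sum_(u <- comul a) u.1 g * u.2 h.
Proof. by rewrite /comul; case: cid. Qed.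

(* terms a_1 (x) a_2 (x) a_3 of (Delta (x) id) (Delta(a)) *)
Definition comul3 a : seq (coordAlg G * coordAlg G * coordAlg G) :=
  [seq (v.1, v.2, u.2) | u <- comul a, v <- comul u.1].

Lemma comul3E a g h l : a (g * h * l)%g = \sum_(u <- comul3 a) u.1.1 g * u.1.2 h * u.2 l.
Proof.
rewrite big_allpairs_dep comulE; apply: eq_bigr => u _.
by rewrite comulE mulr_suml.
Qed.

Definition conv2 (f h : coordAlg G -> coordAlg G -> k) a b : k :=
  \sum_(u <- comul a) \sum_(v <- comul b) f u.1 v.1 * h u.2 v.2.

End Comultiplication.

(* A linear form on O(G) (x) O(G) is given as a bilinear form on O(G). The
   convolution inverse is unique (cocycle_inv_unique). *)
Record hopf_cocycle (k : closedFieldType) (G : affGroup k) := HopfCocycle {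
  cocycle_form :> coordAlg G -> coordAlg G -> k;
  cocycle_inv : coordAlg G -> coordAlg G -> k;
  cocycle_bilinear : bilinear_form cocycle_form;
  cocycle_inv_bilinear : bilinear_form cocycle_inv;
  cocycle_convV : forall a b, conv2 cocycle_form cocycle_inv a b = counit a * counit b;
  cocycle_convVl : forall a b, conv2 cocycle_inv cocycle_form a b = counit a * counit b;
  cocycle_eq : forall a b c,
    \sum_(u <- comul a) \sum_(v <- comul b)
       cocycle_form (u.1 * v.1) c * cocycle_form u.2 v.2 =
    \sum_(v <- comul b) \sum_(w <- comul c)
       cocycle_form a (v.1 * w.1) * cocycle_form v.2 w.2;
  cocycle_1r : forall a, cocycle_form a 1 = counit a;
  cocycle_1l : forall a, cocycle_form 1 a = counit a
}.

Section Forms.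
Variables (k : closedFieldType) (G : affGroup k).
Local Notation A := (coordAlg G).
Implicit Types (a b c : A).

(* R^J = J_21^{-1} * J, where J_21^{-1}(a, b) = J^{-1}(b, a) *)
Definition Rform (J : hopf_cocycle G) : A -> A -> k :=
  conv2 (fun a b => cocycle_inv J b a) J.

Definition nondegenerate (f : A -> A -> k) : Prop :=
  (forall a, (forall b, f a b = 0) -> a = 0) /\
  (forall b, (forall a, f a b = 0) -> b = 0).

Definition minimal_cocycle (J : hopf_cocycle G) : Prop := nondegenerate (Rform J).

(* a (x) b |-> J^{-1}(a_1, b_1) a_2 b_2 J(a_3, b_3) *)
Definition tmul (J : hopf_cocycle G) a b : A :=
  \sum_(u <- comul3 a) \sum_(v <- comul3 b)
     (cocycle_inv J u.1.1 v.1.1 * J u.2 v.2) *: (u.1.2 * v.1.2).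

End Forms.

Record closed_subgroup (k : closedFieldType) (G : affGroup k) := ClosedSubgroup {
  subset_of :> set G;
  subgroup1 : subset_of 1%g;
  subgroupM : forall g h, subset_of g -> subset_of h -> subset_of (g * h)%g;
  subgroupV : forall g, subset_of g -> subset_of (g^-1)%g;
  subgroup_closed : zariski_closed [set coordf g | g in subset_of]
}.

Section ClosedSubgroup.
Variables (k : closedFieldType) (G : affGroup k) (H : closed_subgroup G).

Definition subgroup_pred : {pred G} := fun g => `[< (H : set G) g >].
Lemma subgroup_predP g : reflect ((H : set G) g) (g \in subgroup_pred).
Proof. exact: asboolP. Qed.

Record subgroup_points := SubgroupPoint { sgval : G; _ : sgval \in subgroup_pred }.
HB.instance Definition _ := [isSub for sgval].
HB.instance Definition _ := [Choice of subgroup_points by <:].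

Fact subgroup_group_closed : group_closed subgroup_pred.
Proof.
split; first by apply/subgroup_predP; exact: subgroup1.
move=> g h /subgroup_predP Hg /subgroup_predP Hh; apply/subgroup_predP.
by apply: subgroupM => //; exact: subgroupV.
Qed.
HB.instance Definition _ :=
  SubChoice_isSubGroup.Build G subgroup_pred subgroup_points subgroup_group_closed.

Let scoord (h : subgroup_points) := coordf (val h).

Fact scoord_inj : injective scoord.
Proof. by move=> g h /coordf_inj/val_inj. Qed.

Fact scoord_closed : zariski_closed (range scoord).
Proof.
suff -> : range scoord = [set coordf g | g in H] by exact: subgroup_closed.
apply/seteqP; split=> x /=.
  by move=> [h _ <-]; exists (val h) => //; exact/subgroup_predP/valP.
move=> [g Hg <-]; have gH : g \in subgroup_pred by exact/subgroup_predP.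
by exists (SubgroupPoint gH).
Qed.

Fact scoord_mul i : exists p : {mpoly k[adim G + adim G]},
  forall g h, scoord (g * h)%g i = p.@[glue (scoord g) (scoord h)].
Proof. by have [p pE] := coordf_mul i; exists p => g h; rewrite -pE. Qed.

Fact scoord_inv i : exists p : {mpoly k[adim G]},
  forall g, scoord (g^-1)%g i = p.@[scoord g].
Proof. by have [p pE] := coordf_inv i; exists p => g; rewrite -pE. Qed.

Definition subgroup_affGroup : affGroup k :=
  AffGroup scoord_inj scoord_closed scoord_mul scoord_inv.

Fact res_regular (a : coordAlg G) :
  (fun h : subgroup_affGroup => a (sgval h)) \in @regular k subgroup_affGroup.
Proof.
have /regularP[p ap] := valP a; apply/regularP; exists p => h; exact: ap.
Qed.
Definition res (a : coordAlg G) : coordAlg subgroup_affGroup := CoordAlg (res_regular a).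

Lemma resE a (h : subgroup_affGroup) : res a h = a (sgval h). Proof. by []. Qed.

Definition pullback (f : coordAlg subgroup_affGroup -> coordAlg subgroup_affGroup -> k)
  (a b : coordAlg G) : k := f (res a) (res b).

Definition is_support (J : hopf_cocycle G) : Prop :=
  exists JH : hopf_cocycle subgroup_affGroup,
    minimal_cocycle JH /\ forall a b, J a b = pullback JH a b.

Record double_coset := DoubleCoset {
  dcset :> set G;
  dcsetP : exists g, dcset = [set (h * g * h')%g | h in (H : set G) & h' in (H : set G)]
}.

End ClosedSubgroup.

Section ConvolutionLemmas.
Variables (k : closedFieldType) (G : affGroup k).
Local Notation A := (coordAlg G).
Implicit Types (a b c : A).

Definition sw a (F : A -> A -> k) := \sum_(u <- comul a) F u.1 u.2.

Lemma sw_ext a F F' : (forall x y, F x y = F' x y) -> sw a F = sw a F'.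
Proof. by move=> FF; apply: eq_bigr => u _; rewrite FF. Qed.

Lemma sw_exch a b (F : A -> A -> A -> A -> k) :
  sw a (fun x y => sw b (fun p q => F x y p q)) =
  sw b (fun p q => sw a (fun x y => F x y p q)).
Proof. exact: exchange_big. Qed.

Lemma sw_mull a F x : x * sw a F = sw a (fun p q => x * F p q).
Proof. by rewrite /sw mulr_sumr. Qed.

Lemma sw_mulr a F x : sw a F * x = sw a (fun p q => F p q * x).
Proof. by rewrite /sw mulr_suml. Qed.

Lemma sw_coassoc (T : A -> A -> A -> k) a : trilinear_form T ->
  sw a (fun x y => sw x (fun p q => T p q y)) = sw a (fun p x => sw x (fun q y => T p q y)).
Proof.
move=> tT; rewrite /sw.
pose s := [seq (comul u.1, u.2) | u <- comul a].
pose t := [seq ([:: (u.1, v.1)], v.2) | u <- comul a, v <- comul u.2].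
have := tensor3_eq tT (s := s) (t := t).
rewrite !big_map big_allpairs_dep /= => st; rewrite st.
  by apply: eq_bigr => u _; apply: eq_bigr => v _; rewrite big_seq1.
move=> g h l; rewrite !big_map big_allpairs_dep /=.
under eq_bigr do rewrite -comulE; rewrite -comulE -mulgA comulE; apply: eq_bigr => u _.
by rewrite comulE mulr_sumr; apply: eq_bigr => v _; rewrite big_seq1 mulrA.
Qed.

Lemma sw_counitl (f : A -> k) a : scalar f -> sw a (fun x y => counit x * f y) = f a.
Proof.
move=> lf; rewrite /sw; under eq_bigr do rewrite -(scalarZ lf).
rewrite -(scalar_sum lf); congr f; apply: coordAlg_eqP => g.
rewrite sumE -[in RHS](mul1g g) comulE; apply: eq_bigr => u _; exact: scaleE.
Qed.

Lemma sw_counitr (f : A -> k) a : scalar f -> sw a (fun x y => f x * counit y) = f a.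
Proof.
move=> lf; rewrite /sw; under eq_bigr do rewrite mulrC -(scalarZ lf).
rewrite -(scalar_sum lf); congr f; apply: coordAlg_eqP => g.
rewrite sumE -[in RHS](mulg1 g) comulE; apply: eq_bigr => u _.
by rewrite mulrC scaleE.
Qed.

Lemma sw_linear (F : A -> A -> k) : bilinear_form F -> scalar (fun a => sw a F).
Proof.
move=> bF c x y; rewrite /sw.
have := tensor_eq bF (s := comul (c *: x + y))
  (t := [seq (c *: u.1, u.2) | u <- comul x] ++ comul y).
rewrite big_cat big_map /= => ->.
  by rewrite mulr_sumr; congr (_ + _); apply: eq_bigr => u _; rewrite (scalarZ (bF.1 _)).
move=> g h; rewrite -comulE big_cat big_map /= addE scaleE !comulE mulr_sumr.
by congr (_ + _); apply: eq_bigr => u _; rewrite scaleE mulrA.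
Qed.

Lemma sw_mul (F : A -> A -> k) a b : bilinear_form F ->
  sw (a * b) F = sw a (fun x y => sw b (fun p q => F (x * p) (y * q))).
Proof.
move=> bF; rewrite /sw.
have := tensor_eq bF (s := comul (a * b))
  (t := [seq (u.1 * v.1, u.2 * v.2) | u <- comul a, v <- comul b]).
rewrite big_allpairs_dep /= => -> // g h.
rewrite -comulE big_allpairs_dep mulE !comulE mulr_suml; apply: eq_bigr => u _.
by rewrite mulr_sumr; apply: eq_bigr => v _; rewrite /= !mulE mulrACA.
Qed.

Lemma sw_one (F : A -> A -> k) : bilinear_form F -> sw 1 F = F 1 1.
Proof.
move=> bF; rewrite /sw.
have := tensor_eq bF (s := comul 1) (t := [:: (1, 1)]).
rewrite big_seq1 /= => -> // g h.
by rewrite -comulE big_seq1 !oneE mulr1.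
Qed.

Lemma scalar_sw a (F : A -> A -> A -> k) :
  (forall p q, scalar (fun x => F x p q)) -> scalar (fun x => sw a (F x)).
Proof.
move=> lF c x y; rewrite /sw mulr_sumr -big_split /=.
by apply: eq_bigr => u _; rewrite lF.
Qed.

Lemma scalar_mull (x : k) (f : A -> k) : scalar f -> scalar (fun a => x * f a).
Proof. by move=> lf c a b; rewrite lf mulrDr mulrCA. Qed.

Lemma scalar_mulr (x : k) (f : A -> k) : scalar f -> scalar (fun a => f a * x).
Proof. by move=> lf c a b; rewrite lf mulrDl mulrA. Qed.

Lemma scalar_argl (f : A -> k) b : scalar f -> scalar (fun a => f (a * b)).
Proof. by move=> lf c x y; rewrite mulrDl -scalerAl lf. Qed.

Lemma scalar_argr (f : A -> k) b : scalar f -> scalar (fun a => f (b * a)).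
Proof. by move=> lf c x y; rewrite mulrDr -scalerAr lf. Qed.

Lemma scalar_ev g : scalar (fun a : A => a g).
Proof. by move=> c x y; rewrite addE scaleE. Qed.

Record tri := Tri { triv :> A -> A -> A -> k; triP : trilinear_form triv }.

Lemma tri_eq (T U : tri) : (forall a b c, T a b c = U a b c) -> T = U.
Proof.
case: T U => [T tT] [U tU] /= TU.
have {}TU : T = U by apply/funext => a; apply/funext => b; apply/funext => c.
by case: _ / TU in tU *; congr Tri; exact: Prop_irrelevance.
Qed.

Definition conv3 (T U : A -> A -> A -> k) a b c : k :=
  sw a (fun a1 a2 => sw b (fun b1 b2 => sw c (fun c1 c2 => T a1 b1 c1 * U a2 b2 c2))).

Fact conv3_tri (T U : tri) : trilinear_form (conv3 T U).
Proof.
have [[T1 T2 T3] [U1 U2 U3]] := (triP T, triP U); split=> [b c|a c|a b]; rewrite /conv3.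
- apply: sw_linear; split=> z; do 2!apply: scalar_sw => ??.
  + exact: scalar_mulr.
  + exact: scalar_mull.
- apply: scalar_sw => ??; apply: sw_linear; split=> z; apply: scalar_sw => ??.
  + exact: scalar_mulr.
  + exact: scalar_mull.
- do 2!apply: scalar_sw => ??; apply: sw_linear; split=> z.
  + exact: scalar_mulr.
  + exact: scalar_mull.
Qed.
Definition tconv T U := Tri (conv3_tri T U).

Lemma tconvA : associative tconv.
Proof.
move=> T U W; apply: tri_eq => a b c /=; rewrite /conv3.
have [[T1 T2 T3] [U1 U2 U3] [W1 W2 W3]] := And3 (triP T) (triP U) (triP W).
symmetry.
transitivity (sw a (fun x y => sw x (fun a1 a2 => sw b (fun x' y' => sw x' (fun b1 b2 =>
   sw c (fun x'' y'' => sw x'' (fun c1 c2 => T a1 b1 c1 * U a2 b2 c2 * W y y' y''))))))).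
  apply: sw_ext => x y.
  under sw_ext => x' y' do under sw_ext => x'' y'' do
    (rewrite sw_mulr; under sw_ext => ?? do
      (rewrite sw_mulr; under sw_ext => ?? do rewrite sw_mulr)).
  under sw_ext => x' y' do rewrite sw_exch.
  rewrite sw_exch; apply: sw_ext => a1 a2; apply: sw_ext => x' y'.
  by rewrite sw_exch.
transitivity (sw a (fun a1 y => sw y (fun a2 a3 => sw b (fun b1 y' => sw y' (fun b2 b3 =>
   sw c (fun c1 y'' => sw y'' (fun c2 c3 => T a1 b1 c1 * U a2 b2 c2 * W a3 b3 c3))))))); last first.
  apply: sw_ext => x y.
  under [RHS]sw_ext => x' y' do under sw_ext => x'' y'' do
    (rewrite sw_mull; under sw_ext => ?? do
      (rewrite sw_mull; under sw_ext => ?? do rewrite sw_mull)).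
  under [RHS]sw_ext => x' y' do rewrite sw_exch.
  rewrite [RHS]sw_exch; apply: sw_ext => a1 a2; apply: sw_ext => x' y'.
  rewrite [RHS]sw_exch; apply: sw_ext => b1 b2; apply: sw_ext => c1 y''.
  by apply: sw_ext => c2 c3; rewrite mulrA.
pose M a1 a2 y b1 b2 y' c1 c2 y'' := T a1 b1 c1 * U a2 b2 c2 * W y y' y''.
rewrite (sw_coassoc (T := fun a1 a2 y => sw b (fun x' y' => sw x' (fun b1 b2 =>
   sw c (fun x'' y'' => sw x'' (fun c1 c2 => M a1 a2 y b1 b2 y' c1 c2 y'')))))); last first.
  split=> [??|??|??]; do 4!apply: scalar_sw => ??; rewrite /M.
  - by apply: scalar_mulr; exact: scalar_mulr.
  - by apply: scalar_mulr; exact: scalar_mull.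
  - exact: scalar_mull.
apply: sw_ext => a1 y; apply: sw_ext => a2 a3.
rewrite (sw_coassoc (T := fun b1 b2 y' =>
   sw c (fun x'' y'' => sw x'' (fun c1 c2 => M a1 a2 a3 b1 b2 y' c1 c2 y'')))); last first.
  split=> [??|??|??]; do 2!apply: scalar_sw => ??; rewrite /M.
  - by apply: scalar_mulr; exact: scalar_mulr.
  - by apply: scalar_mulr; exact: scalar_mull.
  - exact: scalar_mull.
apply: sw_ext => b1 y'; apply: sw_ext => b2 b3.
rewrite (sw_coassoc (T := fun c1 c2 y'' => M a1 a2 a3 b1 b2 b3 c1 c2 y'')) //.
split=> [??|??|??]; rewrite /M.
- by apply: scalar_mulr; exact: scalar_mulr.
- by apply: scalar_mulr; exact: scalar_mull.
- exact: scalar_mull.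
Qed.

Fact tone_tri : trilinear_form (fun a b c => counit a * counit b * counit c).
Proof.
split=> ??; rewrite /counit.
- by apply: scalar_mulr; apply: scalar_mulr; exact: scalar_ev.
- by apply: scalar_mulr; apply: scalar_mull; exact: scalar_ev.
- by apply: scalar_mull; exact: scalar_ev.
Qed.
Definition tone := Tri tone_tri.

Lemma tconv1l : left_id tone tconv.
Proof.
move=> T; apply: tri_eq => a b c; have [T1 T2 T3] := triP T.
rewrite -[RHS](sw_counitl a (T1 b c)); apply: sw_ext => a1 a2.
rewrite -[in RHS](sw_counitl b (T2 a2 c)) sw_mull; apply: sw_ext => b1 b2.
rewrite -[in RHS](sw_counitl c (T3 a2 b2)) !sw_mull; apply: sw_ext => c1 c2.
by rewrite !mulrA.
Qed.

Lemma tconv1r : right_id tone tconv.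
Proof.
move=> T; apply: tri_eq => a b c; have [T1 T2 T3] := triP T.
rewrite -[RHS](sw_counitr a (T1 b c)); apply: sw_ext => a1 a2.
rewrite -[in RHS](sw_counitr b (T2 a1 c)) sw_mulr; apply: sw_ext => b1 b2.
rewrite -[in RHS](sw_counitr c (T3 a1 b1)) !sw_mulr; apply: sw_ext => c1 c2.
by rewrite /= -!mulrA; congr (_ * _); rewrite mulrC -mulrA mulrCA.
Qed.

Lemma tinv_unique (X Y Y' : tri) : tconv X Y = tone -> tconv Y' X = tone -> Y = Y'.
Proof. by move=> XY Y'X; rewrite -[Y]tconv1l -Y'X -tconvA XY tconv1r. Qed.

End ConvolutionLemmas.

Section TwistedAlgebra.
Variables (k : closedFieldType) (G : affGroup k) (J : hopf_cocycle G).
Local Notation A := (coordAlg G).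
Local Notation Ji := (cocycle_inv J).
Implicit Types (a b c : A).

Let Jl b : scalar (J^~ b). Proof. exact: (cocycle_bilinear J).1. Qed.
Let Jr a : scalar (J a). Proof. exact: (cocycle_bilinear J).2. Qed.
Let Jil b : scalar (Ji^~ b). Proof. exact: (cocycle_inv_bilinear J).1. Qed.
Let Jir a : scalar (Ji a). Proof. exact: (cocycle_inv_bilinear J).2. Qed.

Let eps_scalar : scalar (@counit k G).
Proof. exact: scalar_ev. Qed.

Ltac lin := cbv beta; first
  [ exact: Jl | exact: Jr | exact: Jil | exact: Jir | exact: eps_scalar | exact: scalar_ev
  | assumption | match goal with H : _ |- _ => exact: H end
  | apply: scalar_sw => ? ?; lin
  | apply: sw_linear; split=> ?; lin
  | apply: scalar_mulr; lin | apply: scalar_mull; lin ].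

Lemma counitM a b : counit (a * b) = counit a * counit b.
Proof. by []. Qed.
Lemma counit1 : counit (1 : A) = 1.
Proof. by []. Qed.

Lemma tmulL (L : A -> k) a b : scalar L -> L (tmul J a b) =
  sw a (fun a' a3 => sw a' (fun a1 a2 => sw b (fun b' b3 => sw b' (fun b1 b2 =>
    Ji a1 b1 * J a3 b3 * L (a2 * b2))))).
Proof.
move=> lL; rewrite (scalar_sum lL) big_allpairs_dep; apply: eq_bigr => u _.
apply: eq_bigr => u' _; rewrite (scalar_sum lL) big_allpairs_dep; apply: eq_bigr => v _.
by apply: eq_bigr => v' _; rewrite (scalarZ lL).
Qed.

Lemma tmulE a b g : tmul J a b g =
  sw a (fun a' a3 => sw a' (fun a1 a2 => sw b (fun b' b3 => sw b' (fun b1 b2 =>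
    Ji a1 b1 * J a3 b3 * (a2 g * b2 g))))).
Proof. exact: (tmulL _ _ (scalar_ev g)). Qed.

Lemma tmul_scalarl b s x y : tmul J (s *: x + y) b = s *: tmul J x b + tmul J y b.
Proof.
 apply: coordAlg_eqP => g; rewrite addE scaleE.
rewrite !tmulE.
pose F a' a3 := sw a' (fun a1 a2 => sw b (fun b' b3 => sw b' (fun b1 b2 =>
    Ji a1 b1 * J a3 b3 * (a2 g * b2 g)))).
have bF : bilinear_form F by rewrite /F; split=> ?; lin.
exact: (sw_linear bF).
Qed.

Lemma tmul_scalarr a s x y : tmul J a (s *: x + y) = s *: tmul J a x + tmul J a y.
Proof.
 apply: coordAlg_eqP => g; rewrite addE scaleE.
rewrite !tmulE.
pose F b := sw a (fun a' a3 => sw a' (fun a1 a2 => sw b (fun b' b3 => sw b' (fun b1 b2 =>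
    Ji a1 b1 * J a3 b3 * (a2 g * b2 g))))).
have lF : scalar F by rewrite /F; lin.
exact: lF.
Qed.

Let t12 (B : A -> A -> k) a b c := B a b * counit c.
Let t23 (B : A -> A -> k) a b c := counit a * B b c.
Let t12_3 (B : A -> A -> k) a b c := B (a * b) c.
Let t1_23 (B : A -> A -> k) a b c := B a (b * c).

Let t12_tri B : bilinear_form B -> trilinear_form (t12 B).
Proof. by move=> [Bl Br]; split=> ??; rewrite /t12; lin. Qed.
Let t23_tri B : bilinear_form B -> trilinear_form (t23 B).
Proof. by move=> [Bl Br]; split=> ??; rewrite /t23; lin. Qed.
Let t12_3_tri B : bilinear_form B -> trilinear_form (t12_3 B).
Proof.
move=> [Bl Br]; split=> ? z; rewrite /t12_3; last exact: Br.
- exact: (scalar_argl _ (Bl z)).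
- exact: (scalar_argr _ (Bl z)).
Qed.
Let t1_23_tri B : bilinear_form B -> trilinear_form (t1_23 B).
Proof.
move=> [Bl Br]; split=> x z; rewrite /t1_23; first exact: Bl.
- exact: (scalar_argl _ (Br x)).
- exact: (scalar_argr _ (Br x)).
Qed.
Let tg_tri g : trilinear_form (fun a b c => a g * b g * c g).
Proof. by split=> ??; lin. Qed.

Let bJ := cocycle_bilinear J.
Let bJi := cocycle_inv_bilinear J.
Local Notation T12 B := (Tri (t12_tri B)).
Local Notation T23 B := (Tri (t23_tri B)).
Local Notation T12_3 B := (Tri (t12_3_tri B)).
Local Notation T1_23 B := (Tri (t1_23_tri B)).
Local Notation Tg g := (Tri (tg_tri g)).

Lemma conv2E f h a b : conv2 f h a b =
  sw a (fun a1 a2 => sw b (fun b1 b2 => f a1 b1 * h a2 b2)).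
Proof. by []. Qed.

Let conv12 B B' (bB : bilinear_form B) (bB' : bilinear_form B') :
  (forall a b, conv2 B B' a b = counit a * counit b) -> tconv (T12 bB) (T12 bB') = tone G.
Proof.
move=> BB; apply: tri_eq => a b c /=; rewrite -BB conv2E sw_mulr; apply: sw_ext => a1 a2.
rewrite sw_mulr; apply: sw_ext => b1 b2.
by rewrite -(sw_counitl c eps_scalar) sw_mull; apply: sw_ext => c1 c2; rewrite /t12 mulrACA.
Qed.

Let conv23 B B' (bB : bilinear_form B) (bB' : bilinear_form B') :
  (forall a b, conv2 B B' a b = counit a * counit b) -> tconv (T23 bB) (T23 bB') = tone G.
Proof.
move=> BB; apply: tri_eq => a b c /=; rewrite -mulrA -BB conv2E.
rewrite -(sw_counitl a eps_scalar) sw_mulr; apply: sw_ext => a1 a2.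
rewrite sw_mull; apply: sw_ext => b1 b2.
by rewrite sw_mull; apply: sw_ext => c1 c2; rewrite /t23 mulrACA.
Qed.

Let conv12_3 B B' (bB : bilinear_form B) (bB' : bilinear_form B') :
  (forall a b, conv2 B B' a b = counit a * counit b) -> tconv (T12_3 bB) (T12_3 bB') = tone G.
Proof.
have [[Bl Br] [Bl' Br']] := (bB, bB').
move=> BB; apply: tri_eq => a b c /=; rewrite -counitM -BB conv2E sw_mul //.
by split=> ?; lin.
Qed.

Let conv1_23 B B' (bB : bilinear_form B) (bB' : bilinear_form B') :
  (forall a b, conv2 B B' a b = counit a * counit b) -> tconv (T1_23 bB) (T1_23 bB') = tone G.
Proof.
have [[Bl Br] [Bl' Br']] := (bB, bB').
move=> BB; apply: tri_eq => a b c /=; rewrite -mulrA -counitM -BB conv2E; apply: sw_ext => a1 a2.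
by rewrite sw_mul //; split=> ?; lin.
Qed.

Let cocycleT : tconv (T12_3 bJ) (T12 bJ) = tconv (T1_23 bJ) (T23 bJ).
Proof.
apply: tri_eq => a b c; transitivity (sw a (fun a1 a2 => sw b (fun b1 b2 =>
    J (a1 * b1) c * J a2 b2))).
  apply: sw_ext => a1 a2; apply: sw_ext => b1 b2.
  rewrite -(sw_counitr c (Jr (a1 * b1))) sw_mulr; apply: sw_ext => c1 c2 /=.
  by rewrite /t12_3 /t12 mulrA mulrAC.
transitivity (sw b (fun b1 b2 => sw c (fun c1 c2 => J a (b1 * c1) * J b2 c2))).
  exact: cocycle_eq.
symmetry; rewrite /= /conv3 sw_exch; apply: sw_ext => b1 b2.
rewrite sw_exch; apply: sw_ext => c1 c2.
rewrite -(sw_counitr a (Jl (b1 * c1))) sw_mulr; apply: sw_ext => a1 a2.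
by rewrite /t1_23 /t23 mulrA.
Qed.

Let cocycleTi : tconv (T12 bJi) (T12_3 bJi) = tconv (T23 bJi) (T1_23 bJi).
Proof.
apply: (@tinv_unique _ _ (tconv (T12_3 bJ) (T12 bJ))).
  rewrite -tconvA [tconv (T12 _) (tconv _ _)]tconvA (conv12 _ _ (cocycle_convV J)) tconv1l.
  exact: conv12_3 (cocycle_convV J).
rewrite cocycleT -tconvA [tconv (T1_23 _) (tconv _ _)]tconvA.
rewrite (conv1_23 _ _ (cocycle_convVl J)) tconv1l.
exact: conv23 (cocycle_convVl J).
Qed.

Let N g a b := tmul J a b g.
Let bN g : bilinear_form (N g).
Proof.
split=> z c x y; rewrite /N; first by rewrite tmul_scalarl addE scaleE.
by rewrite tmul_scalarr addE scaleE.
Qed.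

Let N12 g : T12_3 (bN g) = tconv (tconv (T12_3 bJi) (Tg g)) (T12_3 bJ).
Proof.
apply: tri_eq => a b c /=; rewrite {1}/t12_3 /N tmulE.
rewrite sw_mul; last by split=> ?; lin.
apply: sw_ext => x y; apply: sw_ext => p q.
rewrite sw_mul; last by split=> ?; lin.
rewrite /conv3; under [RHS]sw_ext => ?? do (rewrite sw_mulr; under sw_ext => ?? do
  (rewrite sw_mulr; under sw_ext => ?? do rewrite sw_mulr)).
rewrite [RHS]sw_exch; apply: sw_ext => x1 x2.
rewrite [RHS]sw_exch; apply: sw_ext => p1 p2.
apply: sw_ext => c' c3; apply: sw_ext => c1 c2.
by rewrite mulE mulrAC.
Qed.

Let N23 g : T1_23 (bN g) = tconv (tconv (T1_23 bJi) (Tg g)) (T1_23 bJ).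
Proof.
apply: tri_eq => a b c /=; rewrite {1}/t1_23 /N tmulE.
apply: sw_ext => x y.
under sw_ext => ?? do (rewrite sw_mul; last by split=> ?; lin).
rewrite sw_exch; apply: sw_ext => p q; rewrite sw_exch; apply: sw_ext => c' c3.
rewrite /conv3 sw_mulr; apply: sw_ext => x1 x2.
rewrite sw_mul; last by split=> ?; lin.
rewrite sw_mulr; apply: sw_ext => p1 p2.
rewrite sw_mulr; apply: sw_ext => c1 c2.
by rewrite mulE [x2 g * _]mulrA mulrAC.
Qed.

Let tmul_assocl g a b c :
  tmul J (tmul J a b) c g = tconv (tconv (T12 bJi) (T12_3 (bN g))) (T12 bJ) a b c.
Proof.
rewrite -[LHS]/(N g (tmul J a b) c) (tmulL a b ((bN g).1 c)).
transitivity (sw a (fun a' a3 => sw b (fun b' b3 =>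
  tconv (T12 bJi) (T12_3 (bN g)) a' b' c * J a3 b3))); last first.
  apply: sw_ext => a' a3; apply: sw_ext => b' b3.
  have [_ _ t3] := triP (tconv (T12 bJi) (T12_3 (bN g))).
  rewrite -[in LHS](sw_counitr c (t3 a' b')) sw_mulr; apply: sw_ext => c' c3.
  by rewrite mulrAC -mulrA.
apply: sw_ext => a' a3; rewrite sw_exch; apply: sw_ext => b' b3.
rewrite sw_mulr; apply: sw_ext => a1 a2; rewrite sw_mulr; apply: sw_ext => b1 b2.
rewrite mulrAC; congr (_ * _).
rewrite -(sw_counitl c ((bN g).2 (a2 * b2))) sw_mull; apply: sw_ext => c1 c2.
by rewrite /t12 mulrA.
Qed.

Let tmul_assocr g a b c :
  tmul J a (tmul J b c) g = tconv (tconv (T23 bJi) (T1_23 (bN g))) (T23 bJ) a b c.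
Proof.
rewrite -[LHS]/(N g a (tmul J b c)) (tmulL b c ((bN g).2 a)).
transitivity (sw b (fun b' b3 => sw c (fun c' c3 =>
  tconv (T23 bJi) (T1_23 (bN g)) a b' c' * J b3 c3))); last first.
  rewrite [RHS]sw_exch; apply: sw_ext => b' b3.
  rewrite [RHS]sw_exch; apply: sw_ext => c' c3.
  have [t1 _ _] := triP (tconv (T23 bJi) (T1_23 (bN g))).
  rewrite -[in LHS](sw_counitr a (t1 b' c')) sw_mulr; apply: sw_ext => a' a3.
  by rewrite -mulrA.
apply: sw_ext => b' b3; rewrite sw_exch; apply: sw_ext => c' c3.
rewrite sw_mulr.
under [RHS]sw_ext => ?? do rewrite sw_mulr.
rewrite [RHS]sw_exch; apply: sw_ext => b1 b2.
under [RHS]sw_ext => ?? do rewrite sw_mulr.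
rewrite [RHS]sw_exch; apply: sw_ext => c1 c2.
rewrite mulrAC -sw_mulr; congr (_ * _).
rewrite -(sw_counitl a ((bN g).1 (b2 * c2))) sw_mull; apply: sw_ext => a1 a2.
by rewrite /t23 mulrCA mulrA.
Qed.

Lemma tmulA : associative (tmul J).
Proof.
move=> a b c; apply: coordAlg_eqP => g.
rewrite tmul_assocr tmul_assocl N12 N23.
by rewrite !tconvA -cocycleTi -!tconvA cocycleT.
Qed.

Lemma cocycle_inv_unique f : bilinear_form f ->
  (forall a b, conv2 f J a b = counit a * counit b) -> forall a b, f a b = Ji a b.
Proof.
move=> bf fJ a b.
have := @tinv_unique _ _ (T12 bJ) (T12 bJi) (T12 bf) (conv12 _ _ (cocycle_convV J)) (conv12 _ _ fJ).
move=> /(congr1 (fun T => triv T a b 1)); rewrite /= /t12 counit1 !mulr1 => -> //.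
Qed.

Lemma cocycle_inv_1l a : Ji 1 a = counit a.
Proof.
have := cocycle_convVl J 1 a; rewrite counit1 mul1r => <-.
rewrite conv2E sw_one; last by split=> ?; lin.
rewrite -[LHS](sw_counitr a (Jir 1)); apply: sw_ext => x y.
by rewrite cocycle_1l.
Qed.

Lemma cocycle_inv_1r a : Ji a 1 = counit a.
Proof.
have := cocycle_convVl J a 1; rewrite counit1 mulr1 => <-.
rewrite conv2E -[LHS](sw_counitr a (Jil 1)); apply: sw_ext => x y.
by rewrite sw_one; [rewrite cocycle_1r | split=> ?; lin].
Qed.

Lemma tmul1l : left_id 1 (tmul J).
Proof.
move=> b; apply: coordAlg_eqP => g; rewrite tmulE.
rewrite sw_one; last by split=> ?; lin.
rewrite sw_one; last by split=> ?; lin.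
rewrite -[RHS](sw_counitr b (scalar_ev g)); apply: sw_ext => b' b3.
rewrite -[in RHS](sw_counitl b' (scalar_ev g)) sw_mulr; apply: sw_ext => b1 b2.
by rewrite cocycle_inv_1l cocycle_1l oneE mul1r mulrAC.
Qed.

Lemma tmul1r : right_id 1 (tmul J).
Proof.
move=> a; apply: coordAlg_eqP => g; rewrite tmulE.
rewrite -[RHS](sw_counitr a (scalar_ev g)); apply: sw_ext => a' a3.
rewrite -[in RHS](sw_counitl a' (scalar_ev g)) sw_mulr; apply: sw_ext => a1 a2.
rewrite sw_one; last by split=> ?; lin.
rewrite sw_one; last by split=> ?; lin.
by rewrite cocycle_inv_1r cocycle_1r oneE mulr1 mulrAC.
Qed.

Lemma tmulDl : left_distributive (tmul J) +%R.
Proof. by move=> a b c; have := tmul_scalarl c 1 a b; rewrite !scale1r. Qed.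

Lemma tmulDr : right_distributive (tmul J) +%R.
Proof. by move=> a b c; have := tmul_scalarr a 1 b c; rewrite !scale1r. Qed.

(* _J O(G) _J: the vector space O(G) with the multiplication [tmul J]; the
   unused argument keeps it apart from O(G) with its pointwise product *)
Definition twisted (_ : hopf_cocycle G) : Type := coordAlg G.
HB.instance Definition _ := GRing.Lmodule.on (twisted J).
HB.instance Definition _ := GRing.Zmodule_isNzRing.Build (twisted J)
  tmulA tmul1l tmul1r tmulDl tmulDr (coordAlg_neq0 G).

Fact twisted_scaleAl (s : k) (a b : (twisted J)) : s *: (a * b) = (s *: a : (twisted J)) * b.
Proof. have := tmul_scalarl b s a 0; rewrite addr0 -[tmul J 0 b]/((0 : (twisted J)) * b) mul0r addr0.
exact: esym. Qed.
HB.instance Definition _ := GRing.Lmodule_isLalgebra.Build k (twisted J) twisted_scaleAl.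
Fact twisted_scaleAr (s : k) (a b : (twisted J)) : s *: (a * b) = a * (s *: b : (twisted J)).
Proof. have := tmul_scalarr a s b 0; rewrite addr0 -[tmul J a 0]/(a * (0 : (twisted J))) mulr0 addr0.
exact: esym. Qed.
HB.instance Definition _ := GRing.Lalgebra_isAlgebra.Build k (twisted J) twisted_scaleAr.

End TwistedAlgebra.

Record two_sided_ideal (k : pzRingType) (A : algType k) := TwoSidedIdeal {
  ideal_set :> set A;
  ideal0 : ideal_set 0;
  idealD : forall a b, ideal_set a -> ideal_set b -> ideal_set (a + b);
  idealMl : forall a b, ideal_set b -> ideal_set (a * b);
  idealMr : forall a b, ideal_set a -> ideal_set (a * b);
  ideal_proper : ~ ideal_set 1
}.

Section QuotientAlgebra.
Variables (k : pzRingType) (A : algType k) (I : two_sided_ideal A).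

Definition ideal_pred : {pred A} := fun a => `[< (I : set A) a >].
Lemma ideal_predP a : reflect ((I : set A) a) (a \in ideal_pred).
Proof. exact: asboolP. Qed.

Fact ideal_zmod_closed : zmod_closed ideal_pred.
Proof.
split; first by apply/ideal_predP; exact: ideal0.
move=> a b /ideal_predP Ia /ideal_predP Ib; apply/ideal_predP/idealD => //.
by rewrite -mulN1r; exact: idealMl.
Qed.
HB.instance Definition _ := GRing.isZmodClosed.Build A ideal_pred ideal_zmod_closed.

Definition quotient_alg : Type := Quotient.quot ideal_pred.
HB.instance Definition _ := GRing.Zmodule.on quotient_alg.

Definition quot_proj (a : A) : quotient_alg := (\pi_(Quotient.quot ideal_pred) a)%qT.
Definition quot_repr (x : quotient_alg) : A := repr x.

Lemma quot_reprK x : quot_proj (quot_repr x) = x.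
Proof. exact: reprK. Qed.

Lemma quot_projP a b : quot_proj a = quot_proj b <-> (I : set A) (a - b).
Proof.
split=> [/eqP|Iab]; last by apply/eqP; rewrite -Quotient.idealrBE; apply/ideal_predP.
by rewrite -Quotient.idealrBE => /ideal_predP.
Qed.

Lemma quot_projD a b : quot_proj (a + b) = quot_proj a + quot_proj b.
Proof. exact: Quotient.pi_add. Qed.

Lemma quot_proj0 : quot_proj 0 = 0.
Proof. by apply: (addrI (quot_proj 0)); rewrite -quot_projD !addr0. Qed.

Lemma quot_repr_proj a : (I : set A) (a - quot_repr (quot_proj a)).
Proof. by apply/quot_projP; rewrite quot_reprK. Qed.

Definition quot_mul x y := quot_proj (quot_repr x * quot_repr y).
Definition quot_scale (s : k) x := quot_proj (s *: quot_repr x).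

Lemma quot_projM a b : quot_mul (quot_proj a) (quot_proj b) = quot_proj (a * b).
Proof.
symmetry; apply/quot_projP; set a' := quot_repr _; set b' := quot_repr _.
have -> : a * b - a' * b' = a * (b - b') + (a - a') * b'.
  by rewrite mulrBr mulrBl addrA subrK.
apply: idealD; first by apply: idealMl; exact: quot_repr_proj.
by apply: idealMr; exact: quot_repr_proj.
Qed.

Lemma quot_projZ s a : quot_scale s (quot_proj a) = quot_proj (s *: a).
Proof.
symmetry; apply/quot_projP; rewrite -scalerBr -mulr_algl.
by apply: idealMl; exact: quot_repr_proj.
Qed.

Lemma quot_ind (P : quotient_alg -> Prop) : (forall a, P (quot_proj a)) -> forall x, P x.
Proof. by move=> Pp x; rewrite -[x]quot_reprK. Qed.

Fact quot_mulA : associative quot_mul.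
Proof. by do 3!elim/quot_ind=> ?; rewrite !quot_projM mulrA. Qed.
Fact quot_mul1l : left_id (quot_proj 1) quot_mul.
Proof. by elim/quot_ind=> ?; rewrite !quot_projM mul1r. Qed.
Fact quot_mul1r : right_id (quot_proj 1) quot_mul.
Proof. by elim/quot_ind=> ?; rewrite !quot_projM mulr1. Qed.
Fact quot_mulDl : left_distributive quot_mul +%R.
Proof. by do 3!elim/quot_ind=> ?; rewrite -quot_projD !quot_projM -quot_projD mulrDl. Qed.
Fact quot_mulDr : right_distributive quot_mul +%R.
Proof. by do 3!elim/quot_ind=> ?; rewrite -quot_projD !quot_projM -quot_projD mulrDr. Qed.
Fact quot_neq0 : quot_proj 1 != 0.
Proof.
apply/eqP; rewrite -[0]quot_reprK => /quot_projP.
have I0 : (I : set A) (quot_repr 0).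
  have := quot_repr_proj 0; rewrite sub0r quot_proj0 => /(idealMl (-1)).
  by rewrite mulN1r opprK.
by move=> /idealD/(_ I0); rewrite subrK; exact: ideal_proper.
Qed.

HB.instance Definition _ := GRing.Zmodule_isNzRing.Build quotient_alg
  quot_mulA quot_mul1l quot_mul1r quot_mulDl quot_mulDr quot_neq0.

Fact quot_scaleA s t x : quot_scale s (quot_scale t x) = quot_scale (s * t) x.
Proof. by elim/quot_ind: x => a; rewrite !quot_projZ scalerA. Qed.
Fact quot_scale1 : left_id 1 quot_scale.
Proof. by elim/quot_ind=> a; rewrite quot_projZ scale1r. Qed.
Fact quot_scaleDr : right_distributive quot_scale +%R.
Proof.
by move=> s; do 2!elim/quot_ind=> ?; rewrite -quot_projD !quot_projZ -quot_projD scalerDr.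
Qed.
Fact quot_scaleDl x : {morph quot_scale^~ x : s t / s + t}.
Proof. by elim/quot_ind: x => a s t; rewrite !quot_projZ -quot_projD scalerDl. Qed.
HB.instance Definition _ := GRing.Zmodule_isLmodule.Build k quotient_alg
  quot_scaleA quot_scale1 quot_scaleDr quot_scaleDl.

Fact quot_scaleAl (s : k) (x y : quotient_alg) : s *: (x * y) = (s *: x : quotient_alg) * y.
Proof.
elim/quot_ind: x => a; elim/quot_ind: y => b.
rewrite -[LHS]/(quot_scale s (quot_mul _ _)) -[RHS]/(quot_mul (quot_scale _ _) _).
by rewrite quot_projM !quot_projZ quot_projM scalerAl.
Qed.
HB.instance Definition _ := GRing.Lmodule_isLalgebra.Build k quotient_alg quot_scaleAl.
Fact quot_scaleAr (s : k) (x y : quotient_alg) : s *: (x * y) = x * (s *: y : quotient_alg).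
Proof.
elim/quot_ind: x => a; elim/quot_ind: y => b.
rewrite -[LHS]/(quot_scale s (quot_mul _ _)) -[RHS]/(quot_mul _ (quot_scale _ _)).
by rewrite quot_projM !quot_projZ quot_projM scalerAr.
Qed.
HB.instance Definition _ := GRing.Lalgebra_isAlgebra.Build k quotient_alg quot_scaleAr.

End QuotientAlgebra.

Section VanishingIdeal.
Variables (k : closedFieldType) (G : affGroup k) (J : hopf_cocycle G).
Variables (H : closed_subgroup G) (supJ : is_support H J).
Local Notation A := (coordAlg G).
Local Notation OH := (coordAlg (subgroup_affGroup H)).

Lemma sw_res (B : OH -> OH -> k) a : bilinear_form B ->
  sw a (fun x y => B (res H x) (res H y)) = sw (res H a) B.
Proof.
move=> bB; rewrite /sw.
have := tensor_eq bB (s := [seq (res H u.1, res H u.2) | u <- comul a]) (t := comul (res H a)).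
rewrite big_map /= => -> // g h.
rewrite big_map -[RHS]comulE.
exact: (esym (comulE a (sgval g) (sgval h))).
Qed.

Lemma res_scalar (f : OH -> k) : scalar f -> scalar (fun a => f (res H a)).
Proof.
move=> lf s x y; rewrite -lf; congr f; exact: coordAlg_eqP.
Qed.

Lemma pullback_bilinear (B : OH -> OH -> k) : bilinear_form B -> bilinear_form (pullback B).
Proof.
move=> [Bl Br]; split=> z; first exact: (res_scalar (Bl (res H z))).
exact: (res_scalar (Br (res H z))).
Qed.

Lemma support_inv (JH : hopf_cocycle (subgroup_affGroup H)) :
  (forall a b, J a b = pullback JH a b) ->
  forall a b, cocycle_inv J a b = pullback (cocycle_inv JH) a b.
Proof.
move=> JJH a b; symmetry; apply: cocycle_inv_unique.
  exact/pullback_bilinear/cocycle_inv_bilinear.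
move=> {a b} a b; have [[Jl Jr] [Jil Jir]] := (cocycle_bilinear JH, cocycle_inv_bilinear JH).
transitivity (conv2 (cocycle_inv JH) JH (res H a) (res H b)); last exact: cocycle_convVl.
rewrite !conv2E -sw_res; last first.
  split=> z; cbv beta; apply: scalar_sw => ??; [exact: scalar_mulr | exact: scalar_mull].
apply: sw_ext => a1 a2; rewrite -sw_res; last first.
  split=> z; cbv beta; [exact: scalar_mulr | exact: scalar_mull].
by apply: sw_ext => b1 b2; rewrite JJH.
Qed.

Lemma double_coset_stable (Z : double_coset H) z h h' :
  (Z : set G) z -> (H : set G) h -> (H : set G) h' -> (Z : set G) (h * z * h')%g.
Proof.
have [g ->] := dcsetP Z; move=> [x Hx [y Hy <-]] Hh Hh'.
exists (h * x)%g; first exact: subgroupM.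
by exists (y * h')%g; [exact: subgroupM | rewrite !mulgA].
Qed.

Definition vanishing (Z : set G) : set A := [set a | forall z, Z z -> a z = 0].

Lemma vanishing_contract (Z : double_coset H) a z (B : OH -> OH -> k) :
  bilinear_form B -> vanishing Z a -> (Z : set G) z ->
  sw a (fun x a3 => sw x (fun a1 a2 => a2 z * B (res H a1) (res H a3))) = 0.
Proof.
move=> bB Za Zz.
have := tensor0 bB (s := [seq (regfun v.2 z *: res H v.1, res H u.2) | u <- comul a, v <- comul u.1]).
rewrite big_allpairs_dep /= => h; rewrite -[RHS]h /sw.
  by apply: eq_bigr => u _; apply: eq_bigr => v _; rewrite (scalarZ (bB.1 _)).
move=> g g'; rewrite big_allpairs_dep /=.
have a0 : a (sgval g * z * sgval g')%g = 0.
  by apply: Za; apply: double_coset_stable => //; apply/subgroup_predP/(valP _).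
rewrite -[RHS]a0 comulE; apply: eq_bigr => u _; rewrite comulE mulr_suml; apply: eq_bigr => v _.
by rewrite scaleE !resE [v.2 z * _]mulrC.
Qed.

Variable Z : double_coset H.
Local Notation IZ := (vanishing Z : set (twisted J)).

Fact vanishing0 : IZ 0. Proof. by []. Qed.
Fact vanishingD a b : IZ a -> IZ b -> IZ (a + b).
Proof. by move=> Za Zb z Zz; rewrite [LHS]addE Za // Zb // addr0. Qed.

Fact vanishingMr a b : IZ a -> IZ (a * b).
Proof.
move=> Za z Zz; rewrite [LHS]tmulE; have [JH [_ JJH]] := supJ.
have [[Jl Jr] [Jil Jir]] := (cocycle_bilinear JH, cocycle_inv_bilinear JH).
under sw_ext => ?? do rewrite sw_exch.
rewrite sw_exch /sw big1 // => u _; rewrite -/(sw _ _).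
under eq_bigr do rewrite exchange_big.
rewrite exchange_big big1 // => v _.
pose B (x y : OH) := cocycle_inv JH x (res H v.1) * JH y (res H u.2) * v.2 z.
have bB : bilinear_form B.
  by split=> ?; rewrite /B; cbv beta; apply: scalar_mulr; [exact: scalar_mulr | exact: scalar_mull].
rewrite -[RHS](vanishing_contract bB Za Zz); apply: eq_bigr => w _; apply: eq_bigr => w' _.
by rewrite (support_inv JJH) JJH /B /pullback mulrCA.
Qed.

Fact vanishingMl a b : IZ b -> IZ (a * b).
Proof.
move=> Zb z Zz; rewrite [LHS]tmulE; have [JH [_ JJH]] := supJ.
have [[Jl Jr] [Jil Jir]] := (cocycle_bilinear JH, cocycle_inv_bilinear JH).
rewrite /sw big1 // => u _; rewrite big1 // => v _.
pose B (x y : OH) := cocycle_inv JH (res H v.1) x * JH (res H u.2) y * v.2 z.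
have bB : bilinear_form B.
  by split=> ?; rewrite /B; cbv beta; apply: scalar_mulr; [exact: scalar_mulr | exact: scalar_mull].
rewrite -[RHS](vanishing_contract bB Zb Zz); apply: eq_bigr => w _; apply: eq_bigr => w' _.
by rewrite (support_inv JJH) JJH /B /pullback mulrA mulrC.
Qed.

Fact vanishing_proper : ~ IZ 1.
Proof.
have [g gE] := dcsetP Z; have Zg : (Z : set G) g.
  rewrite gE; exists 1%g; first exact: subgroup1.
  by exists 1%g; [exact: subgroup1 | rewrite mulg1 mul1g].
by move=> /(_ g Zg) /eqP; rewrite [X in X == _]oneE oner_eq0.
Qed.

Definition vanishing_ideal : two_sided_ideal (twisted J) :=
  TwoSidedIdeal vanishing0 vanishingD vanishingMl vanishingMr vanishing_proper.

End VanishingIdeal.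

Section Representations.
Variables (k : pzRingType) (A : algType k) (V : lmodType k).

Record representation := Representation {
  act :> A -> V -> V;
  act_linearl : forall v, linear (act^~ v);
  act_linearr : forall a, linear (act a);
  act1 : forall v, act 1 v = v;
  actM : forall a b v, act (a * b) v = act a (act b v)
}.

Definition irreducible (rho : representation) : Prop :=
  (exists v : V, v != 0) /\
  forall W : set V,
    W 0 -> (forall (s : k) v w, W v -> W w -> W (s *: v + w)) ->
    (forall a v, W v -> W (rho a v)) ->
    W = [set 0] \/ W = setT.

End Representations.

Definition factors_through (k : pzRingType) (A : algType k) (V : lmodType k)
    (rho : representation A V) (I : two_sided_ideal A) : Prop :=
  exists sigma : representation (quotient_alg I) V,
    forall a v, rho a v = sigma (quot_proj I a) v.

(* Every g in G is unipotent: the right translation r_g by g is locally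
   unipotent on O(G), i.e. every f is killed by some power of r_g - id. *)
Definition unipotent (k : closedFieldType) (G : affGroup k) : Prop :=
  forall (g : G) (f : coordAlg G), exists N,
    forall x, iter N (fun (f : G -> k) x => f (x * g)%g - f x) f x = 0.

(* Main.v *)
From HB Require Import structures.
From mathcomp Require Import all_boot all_order all_algebra.
From mathcomp Require Import mathcomp_extra boolp classical_sets functions cardinality reals.
From mathcomp Require Import complex ring lra.
From mathcomp Require Import mpoly.
From mathcomp Require finmap.
Require Import Defs.

Set Implicit Arguments.
Unset Strict Implicit.
Unset Printing Implicit Defensive.

Import Order.TTheory GRing.Theory Num.Theory.
Local Open Scope classical_set_scope.
Local Open Scope ring_scope.

(** Let [A = O(G)], on which [H x H] acts by translations on both sides, and call
    an ideal of [A], for the pointwise product, stable if [H x H] preserves it.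
    Everything rests on one property of unipotent groups (Kolchin's theorem): if
    [M < K] are stable subspaces of [A], some function in [K] but not in [M] is
    invariant modulo [M] ([fixed_vector2], [exists_invariant_mod]).

    Existence.  Let [I] be the largest stable ideal that annihilates [V]
    ([stable_annihilator]).  The cocycle and its inverse are pulled back from [H],
    so a function that is [H x H]-invariant modulo [I] has the same products modulo
    [I] in the twisted algebra as in [A] ([tmul_invariantl], [tmul_invariantr]); in
    particular it acts on [V] by an endomorphism, and hence by a scalar, because [V]
    has countable dimension over an uncountable algebraically closed field
    ([spectrum_mod], [invariant_acts_by_scalar]).  The same countability argument
    gives the Nullstellensatz ([proper_ideal_character], [coord_ideal_zero]), so [I]
    has a zero [g]; being stable, it vanishes on [Z = H g H].  If some function
    vanishing on [Z] were not in [I], then one, [w], would moreover be invariant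
    modulo [I], and act by a scalar [c].  Now [w - c] generates together with [I] a
    stable ideal annihilating [V], so [w - c] is in [I] and vanishes at [g]; hence
    [c = 0] and [w] is in [I], a contradiction.  Thus [I = I(Z)]
    ([stable_annihilator_orbit]).

    Uniqueness.  If [I(Z')] annihilates [V], then [I(Z')] is contained in
    [I = I(Z)], that is, [Z] lies in the closure of [Z'], and it remains to see that
    double cosets are closed ([orbit_closed]).  An invariant function on [Z'] is
    constant, so [A / I(Z')] has no stable ideal but [0] and itself
    ([vanishing_maximal]).  Pull this ring back to [O(H x H)] along the orbit map of
    a point [g'] of [Z'], and build up [O(H x H)] from it by adjoining elements that
    are invariant modulo what has been reached: the annihilator of each new element
    is a stable ideal, hence zero, so each step adds a free summand
    ([maxideal_mul_extend]).  Therefore the maximal ideal of a point [x] of the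
    closure of [Z'] generates a proper ideal of [O(H x H)]; a zero [(h, h')] of that
    ideal satisfies [h g' h' = x]. *)

(** * Subspaces and locally finite actions *)

Definition subspace (k : pzRingType) (E : lmodType k) (W : set E) : Prop :=
  W 0 /\ forall c v w, W v -> W w -> W (c *: v + w).

Definition lspan (k : pzRingType) (E : lmodType k) (S : set E) : set E :=
  [set v | forall W, subspace W -> S `<=` W -> W v].

Section Subspaces.
Variables (k : pzRingType) (E : lmodType k).
Implicit Types (W S : set E).

Lemma subspace0 W : subspace W -> W 0. Proof. by case. Qed.
Lemma subspaceD W v w : subspace W -> W v -> W w -> W (v + w).
Proof. by move=> [_ sW] Wv Ww; rewrite -[v]scale1r; exact: sW. Qed.
Lemma subspaceZ W c v : subspace W -> W v -> W (c *: v).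
Proof. by move=> [W0 sW] Wv; rewrite -[_ *: v]addr0; exact: sW. Qed.
Lemma subspaceN W v : subspace W -> W v -> W (- v).
Proof. by rewrite -scaleN1r; exact: subspaceZ. Qed.
Lemma subspaceB W v w : subspace W -> W v -> W w -> W (v - w).
Proof. by move=> sW Wv Ww; apply: subspaceD => //; exact: subspaceN. Qed.
Lemma subspace_sum W I (r : seq I) (P : pred I) (F : I -> E) :
  subspace W -> (forall i, P i -> W (F i)) -> W (\sum_(i <- r | P i) F i).
Proof.
move=> sW WF; apply: big_ind => //; first exact: subspace0.
by move=> v w; exact: subspaceD.
Qed.
Lemma subspace_trans W u v w : subspace W -> W (u - v) -> W (v - w) -> W (u - w).
Proof. by move=> sW uv vw; rewrite -(subrK v u) -addrA; exact: subspaceD. Qed.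

Lemma lspan_subspace S : subspace (lspan S).
Proof.
split=> [W sW _|c v w Sv Sw W sW SW]; first exact: subspace0.
by apply: sW.2; [exact: Sv | exact: Sw].
Qed.
Lemma sub_lspan S : S `<=` lspan S.
Proof. by move=> v Sv W _; exact. Qed.
Lemma lspan_min S W : subspace W -> S `<=` W -> lspan S `<=` W.
Proof. by move=> sW SW v; exact. Qed.
End Subspaces.

Section LinearOperators.
Variables (k : pzRingType) (E E' : lmodType k) (T : E -> E').
Hypothesis linT : linear T.

Lemma linearop0 : T 0 = 0.
Proof. by have := linT (-1) 0 0; rewrite scaler0 addr0 scaleN1r addNr. Qed.
Lemma linearopB u v : T (u - v) = T u - T v.
Proof. by rewrite -scaleN1r addrC linT scaleN1r addrC. Qed.
Lemma linearopZ c v : T (c *: v) = c *: T v.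
Proof. by rewrite -[c *: v]addr0 linT linearop0 addr0. Qed.
Lemma linearop_comb m (c : 'I_m -> k) w : T (\sum_i c i *: w i) = \sum_i c i *: T (w i).
Proof. by elim/big_rec2: _ => [|i x y _ <-]; [exact: linearop0 | rewrite linT]. Qed.
End LinearOperators.

Section LocallyFinite.
Variables (k : pzRingType) (E : lmodType k).

Definition finite_orbit (S : set (E -> E)) v := exists n (e : 'I_n -> E),
  forall s, S s -> exists c : 'I_n -> k, s v = \sum_i c i *: e i.

Definition unipotent_at (s : E -> E) v := exists d, iter d (fun x => s x - x) v = 0.

Lemma finite_orbit_subspace (S : set (E -> E)) :
  (forall s, S s -> linear s) -> subspace (finite_orbit S).
Proof.
move=> lS; split=> [|a v w [m [e eE]] [n [f fE]]].
  exists 0%N, (fun=> 0) => s Ss; exists (fun=> 0).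
  by rewrite big_ord0 (linearop0 (lS s Ss)).
exists (m + n)%N, (fun i => match fintype.split i with inl j => e j | inr j => f j end).
move=> s Ss; have [[c cE] [d dE]] := (eE s Ss, fE s Ss).
exists (fun i => match fintype.split i with inl j => a * c j | inr j => d j end).
rewrite (lS s Ss) cE dE big_split_ord scaler_sumr /=; congr (_ + _); apply: eq_bigr => i _.
  by rewrite (unsplitK (inl i)) scalerA.
by rewrite (unsplitK (inr i)).
Qed.

Lemma unipotent_at_subspace (s : E -> E) : linear s -> subspace (unipotent_at s).
Proof.
move=> ls; pose s1 x := s x - x.
have ls1 : linear s1 by move=> a x y; rewrite /s1 ls scalerBr opprD addrACA.
have lsd d : linear (iter d s1) by move=> a x y; elim: d => //= d ->; exact: ls1.
have s0 d : iter d s1 0 = 0 by exact: linearop0.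
split=> [|a v w [m mv] [n nw]]; first by exists 0%N.
have v0 : iter (m + n) s1 v = 0 by rewrite addnC iterD mv s0.
have w0 : iter (m + n) s1 w = 0 by rewrite iterD nw s0.
by exists (m + n)%N; rewrite -/s1 lsd v0 w0 scaler0 addr0.
Qed.

Definition preserves (S : set (E -> E)) (W : set E) := forall s v, S s -> W v -> W (s v).

(** A monoid [S] of unipotent operators acting on [K] in a locally finite way. *)
Definition unipotent_monoid (S : set (E -> E)) (K : set E) :=
  [/\ S id, forall s t, S s -> S t -> S (s \o t), forall s, S s -> linear s,
      forall v, K v -> finite_orbit S v
    & forall s v, S s -> K v -> unipotent_at s v].
End LocallyFinite.

(** * Kolchin's theorem and fixed vectors *)

Section Matrices.
Variable k : closedFieldType.

Lemma horner_mx_eigen n (A : 'M[k]_n.+1) (v : 'rV_n.+1) a (p : {poly k}) :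
  v *m A = a *: v -> v *m horner_mx A p = p.[a] *: v.
Proof.
move=> vA; elim/poly_ind: p => [|p c IHp]; first by rewrite rmorph0 mulmx0 horner0 scale0r.
rewrite rmorphD rmorphM /= horner_mx_X horner_mx_C hornerMXaddC mulmxDr.
by rewrite mulmxA IHp -scalemxAl vA scalerA mul_mx_scalar scalerDl.
Qed.

Lemma trace_nilpotent n (N : 'M[k]_n.+1) d : N ^+ d = 0 -> \tr N = 0.
Proof.
move=> Nd; have [rs rsE] := closed_field_poly_normal (char_poly N).
rewrite (monicP (char_poly_monic N)) scale1r in rsE.
have rs0 : all (pred1 0) rs.
  apply/allP => r rrs /=; have : root (char_poly N) r by rewrite rsE root_prod_XsubC.
  rewrite -eigenvalue_root_char => /eigenvalueP[v vN v0].
  have := horner_mx_eigen ('X^d) vN; rewrite rmorphXn /= horner_mx_X Nd mulmx0 hornerXn.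
  move/esym/eqP; rewrite scaler_eq0 (negPf v0) orbF expf_eq0 => /andP[_]; exact.
have rsz : size rs = n.+1.
  by have := size_char_poly N; rewrite rsE size_prod_XsubC => -[].
have {}rsE : char_poly N = 'X^(n.+1).
  rewrite rsE -rsz; elim: rs rs0 {rsE rsz} => [|r s IHs] /=; first by rewrite big_nil.
  by move=> /andP[/eqP-> /IHs sE]; rewrite big_cons sE subr0 exprS.
have := char_poly_trace N isT; rewrite rsE coefXn /= eqn_leq ltnn andbF /=.
by move/esym/eqP; rewrite oppr_eq0 => /eqP.
Qed.

(** In a rank factorization [P = L M] of an idempotent, [M L = 1]. *)
Lemma trace_idempotent n (P : 'M[k]_n) : P *m P = P -> \tr P = (\rank P)%:R.
Proof.
move=> PP; pose L := col_base P; pose M := row_base P.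
have LM : L *m M = P by exact: mulmx_base.
have ML : M *m L = 1%:M.
  apply: (row_free_inj (row_base_free P)); rewrite /= mul1mx.
  apply: (row_full_inj (col_base_full P)).
  by move: PP; rewrite -{1 2 3}LM /= !mulmxA.
by rewrite -{1}LM mxtrace_mulC ML mxtrace1.
Qed.

Hypothesis k0 : [pchar k] =i pred0.

(** Were [w] fixed by [A], a polynomial in [A] without constant term would be a
    nonzero idempotent, whose trace is its rank. *)
Lemma no_fixed_row n (A : 'M[k]_n.+1) (w : 'rV_n.+1) :
  (forall d, \tr (A ^+ d.+1) = 0) -> w *m A = w -> w = 0.
Proof.
move=> trA wA; apply/eqP/negPn/negP => w0.
have wAp p : w *m horner_mx A p = p.[1] *: w.
  by apply: horner_mx_eigen; rewrite scale1r.
have [r [q q1 mE]] := multiplicity_XsubC (char_poly A) 1.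
rewrite monic_neq0 ?char_poly_monic //= in q1.
have cop : coprimep (('X - 1%:P) ^+ r) ('X * q).
  rewrite coprimep_expl // coprimep_sym coprimep_XsubC rootM negb_or q1 andbT.
  by rewrite /root hornerX oner_eq0.
have /Bezout_eq1_coprimepP[[u v] /= uv] := cop.
pose p := v * ('X * q); pose P := horner_mx A p.
have CH : horner_mx A (q * ('X - 1%:P) ^+ r) = 0 by rewrite -mE Cayley_Hamilton.
have PP : P *m P = P.
  apply/eqP; rewrite -subr_eq0; apply/eqP.
  rewrite -[P *m P]/(P * P) -rmorphM -rmorphB /=.
  have -> : p * p - p = - (u * v * 'X) * (q * ('X - 1%:P) ^+ r).
    transitivity (p * (p - 1)); first by rewrite mulrBr mulr1.
    rewrite -uv -/p opprD addrCA subrr addr0 /p.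
    by ring.
  by rewrite [LHS]rmorphM /= CH mulr0.
have trp (s : {poly k}) : \tr (horner_mx A ('X * s)) = 0.
  elim/poly_ind: s => [|s c IHs]; first by rewrite mulr0 rmorph0 mxtrace0.
  suff trX d (t : {poly k}) : \tr (horner_mx A ('X^(d.+1) * t)) = 0 by have := trX 0 (s * 'X + c%:P).
  elim/poly_ind: t d {s c IHs} => [|s c IHs] d; first by rewrite mulr0 rmorph0 mxtrace0.
  rewrite mulrDr [s * _]mulrC mulrA -exprSr rmorphD mxtraceD IHs add0r rmorphM /=.
  by rewrite horner_mx_C rmorphXn /= horner_mx_X [_ * _]mul_mx_scalar mxtraceZ trA mulr0.
have P0 : P = 0.
  have := trace_idempotent PP; rewrite {1}/P /p mulrCA trp => /esym/eqP.
  by rewrite ((pcharf0P k).1 k0) mxrank_eq0 => /eqP.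
have wP := wAp p; rewrite -/P P0 mulmx0 in wP.
case: r => [|r] in mE cop uv CH *.
  have := wAp (char_poly A); rewrite Cayley_Hamilton mulmx0 => /esym/eqP.
  by rewrite scaler_eq0 (negPf w0) orbF -/(root _ _) mE expr0 mulr1 (negPf q1).
have := congr1 (fun t => t.[1]) uv; rewrite hornerD -/p hornerM horner_exp hornerXsubC subrr.
rewrite expr0n mulr0 add0r hornerC => p1; rewrite p1 scale1r in wP.
by rewrite -wP eqxx in w0.
Qed.

Lemma subspace_row n (X : set 'rV[k]_n) : subspace X ->
  exists M : 'M[k]_n, forall v, X v <-> (v <= M)%MS.
Proof.
move=> sX; pose P r := `[< exists2 M : 'M[k]_n, (forall v : 'rV_n, (v <= M)%MS -> X v) & \rank M = r >].
have exP : exists r, P r.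
  exists 0; apply/asboolP; exists 0; rewrite ?mxrank0 // => v; rewrite submx0 => /eqP->.
  exact: subspace0.
have ubP r : P r -> (r <= n)%N by move=> /asboolP[M _ <-]; exact: rank_leq_row.
case: (ex_maxnP exP ubP) => r /asboolP[M MX rkM] maxr.
exists M => v; split=> [Xv|]; last exact: MX.
apply: contrapT => /negP nvM; have /maxr : P (\rank (M + v)%MS).
  apply/asboolP; exists (M + v)%MS => // w /sub_addsmxP[[a b] /= ->].
  apply: subspaceD => //; first by apply: MX; exact: submxMl.
  by rewrite [b]mx11_scalar mul_scalar_mx; exact: subspaceZ.
apply/negP; rewrite -ltnNge -rkM; apply: rank_ltmx.
rewrite ltmxE addsmxSl /=; apply: contra nvM; apply: submx_trans; exact: addsmxSr.
Qed.

(** Kolchin.  The span [A] of the [M - 1] is an algebra of traceless matrices,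
    so no nonzero row is fixed by an element of [A]; a row [w] with [w A] of least
    dimension is then killed by [A]. *)
Lemma kolchin n (S : set 'M[k]_n.+1) :
  (forall M N, S M -> S N -> S (M * N)) ->
  (forall M, S M -> exists d, (M - 1) ^+ d = 0) ->
  exists2 w : 'rV_n.+1, w != 0 & forall M, S M -> w *m M = w.
Proof.
move=> SM Su; pose A := lspan [set M - 1 | M in S].
have sA : subspace A by exact: lspan_subspace.
have A1 M : S M -> A (M - 1) by move=> SMm; apply: sub_lspan; exists M.
have AM X Y : A X -> A Y -> A (X * Y).
  move=> AX AY; move: X AX; apply: lspan_min.
    by split=> [|c X X' AX AX']; rewrite ?mul0r ?mulrDl -?scalerAl; [exact: sA.1 | exact: sA.2].
  move=> _ [M SMm <-]; move: Y AY; apply: lspan_min.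
    by split=> [|c X X' AX AX']; rewrite /= ?mulr0 ?mulrDr -?scalerAr; [exact: sA.1 | exact: sA.2].
  move=> _ [N SN <-] /=.
  have -> : (M - 1) * (N - 1) = (M * N - 1) - (M - 1) - (N - 1).
    by rewrite mulrBr mulr1 mulrBl mul1r [RHS]addrAC; congr (_ - _); rewrite opprB addrA subrK.
  have AMN : A (M * N - 1) by apply: A1; exact: SM.
  apply: (subspaceB sA (subspaceB sA AMN _)); exact: A1.
have trA : forall X, A X -> \tr X = 0.
  apply: lspan_min; first by split=> [|c X Y /= X0 Y0]; rewrite /= ?mxtrace0 // mxtraceD mxtraceZ X0 Y0 mulr0 addr0.
  by move=> _ [M /Su[d Md] <-]; exact: trace_nilpotent Md.
have nofix (w : 'rV_n.+1) X : A X -> w *m X = w -> w = 0.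
  move=> AX wX; apply: (no_fixed_row _ wX) => d; apply: trA.
  by elim: d => [|d IHd]; rewrite ?expr1 // exprS; exact: AM.
pose wA (w : 'rV_n.+1) := [set w *m X | X in A].
have swA w : subspace (wA w).
  split=> [|c _ _ [X AX <-] [Y AY <-]]; first by exists 0; rewrite ?mulmx0 //; exact: sA.1.
  by exists (c *: X + Y); rewrite ?mulmxDr -?scalemxAr //; exact: sA.2.
have [M ME] := choice (fun w => subspace_row (swA w)).
pose P r := `[< exists2 w : 'rV_n.+1, w != 0 & \rank (M w) = r >].
have exP : exists r, P r.
  exists (\rank (M (const_mx 1))); apply/asboolP; exists (const_mx 1) => //.
  by apply/eqP => /matrixP/(_ 0 0); rewrite !mxE => /eqP; rewrite oner_eq0.
case: (ex_minnP exP) => r /asboolP[w w0 rk] minr.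
exists w => // N SN; apply/eqP; rewrite -subr_eq0 -[X in _ - X]mulmx1 -mulmxBr.
apply/negPn/negP => w'0; set w' := w *m _ in w'0.
have sub : (M w' <= M w)%MS.
  apply/row_subP => i; apply/ME; have /ME[X AX <-] := row_sub i (M w').
  exists ((N - 1) * X); last by rewrite mulmxA.
  by apply: AM => //; exact: A1.
have rk' : (r <= \rank (M w'))%N by apply: minr; apply/asboolP; exists w'.
have ww' : (M w <= M w')%MS by rewrite -mxrank_leqif_sup // eqn_leq mxrankS //= rk.
have /ME[Y AY wY] : (w' <= M w')%MS.
  by apply: submx_trans ww'; apply/ME; exists (N - 1) => //; exact: A1.
by have /eqP := nofix _ _ AY wY; rewrite (negPf w'0).
Qed.

Section FixedVector.
Variables (E : lmodType k) (K M : set E).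

Lemma subspace_comb (W : set E) m (c : 'I_m -> k) (w : 'I_m -> E) :
  subspace W -> (forall i, W (w i)) -> W (\sum_i c i *: w i).
Proof. by move=> sW Ww; apply: subspace_sum => // i _; exact: subspaceZ. Qed.

Lemma comb_span n m (e : 'I_n -> E) (w : 'I_m -> E) : (n < m)%N ->
  (forall i, exists c : 'I_n -> k, w i = \sum_j c j *: e j) ->
  exists2 c : 'rV[k]_m, c != 0 & \sum_i c 0 i *: w i = 0.
Proof.
move=> nm /choice[a wE]; pose A := \matrix_(i < m, j < n) a i j.
have : kermx A != 0.
  rewrite -mxrank_eq0 mxrank_ker -lt0n subn_gt0; exact: leq_ltn_trans (rank_leq_col _) nm.
move=> /rowV0Pn[c /sub_kermxP cA c0]; exists c => //.
under eq_bigr do rewrite wE scaler_sumr.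
rewrite exchange_big big1 //= => j _.
under eq_bigr do rewrite scalerA.
rewrite -scaler_suml; have /rowP/(_ j) := cA; rewrite !mxE.
by under eq_bigr do rewrite mxE; move=> ->; rewrite scale0r.
Qed.

Definition indep_mod m (w : 'I_m -> E) :=
  forall c : 'rV[k]_m, M (\sum_i c 0 i *: w i) -> c = 0.

Lemma indep_mod_extend m (w : 'I_m -> E) v : subspace M -> indep_mod w ->
  (forall c : 'rV[k]_m, ~ M (v - \sum_i c 0 i *: w i)) ->
  indep_mod (fun i : 'I_m.+1 => oapp w v (unlift ord0 i)).
Proof.
move=> sM iw nv c; rewrite big_ord_recl unlift_none /=.
under eq_bigr do rewrite liftK /=.
have [c0|c0] := eqVneq (c 0 0) 0.
  rewrite c0 scale0r add0r => Mc; apply/rowP => i; rewrite mxE.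
  case: (unliftP ord0 i) => [j|] -> //.
  have := iw (\row_j c 0 (lift ord0 j)); under eq_bigr do rewrite mxE.
  by move=> /(_ Mc)/rowP/(_ j); rewrite !mxE.
move=> Mc; exfalso; apply: (nv (\row_j (- (c 0 0)^-1 * c 0 (lift ord0 j)))).
have := subspaceZ (c 0 0)^-1 sM Mc; rewrite scalerDr scalerA mulVf // scale1r.
congr (M (_ + _)); rewrite scaler_sumr -sumrN; apply: eq_bigr => i _.
by rewrite mxE mulNr scaleNr opprK scalerA.
Qed.

Hypotheses (sK : subspace K) (sM : subspace M).

(** The translates of [f] span a finite-dimensional space; Kolchin's theorem is
    applied to the matrices of [S] in a basis of that space modulo [M]. *)
Lemma fixed_vector (S : set (E -> E)) f :
  unipotent_monoid S K -> preserves S K -> preserves S M -> K f -> ~ M f ->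
  exists w, [/\ K w, ~ M w & forall s, S s -> M (s w - w)].
Proof.
move=> [S1 SC Slin Sfin Suni] SK SM Kf nMf; pose W := lspan [set s f | s in S].
have sW : subspace W by exact: lspan_subspace.
have WK : W `<=` K by apply: lspan_min => // _ [s Ss <-]; exact: SK.
have SW s v : S s -> W v -> W (s v).
  move=> Ss; move: v; apply: lspan_min.
    split=> [|c v w Wv Ww] /=; first by rewrite (linearop0 (Slin _ Ss)); exact: sW.1.
    by rewrite (Slin _ Ss); exact: sW.2.
  by move=> _ [t St <-]; apply: sub_lspan; exists (s \o t) => //; exact: SC.
have Wf : W f by apply: sub_lspan; exists id.
have [n [e fE]] := Sfin _ Kf.
have WE v : W v -> exists c : 'I_n -> k, v = \sum_i c i *: e i.
  move: v; apply: lspan_min; last by move=> _ [s Ss <-]; exact: fE.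
  split=> [|a v w [c ->] [d ->]].
    by exists (fun=> 0); rewrite big1 // => i _; rewrite scale0r.
  exists (fun i => a * c i + d i); rewrite scaler_sumr -big_split; apply: eq_bigr => i _.
  by rewrite scalerDl scalerA.
pose P m := `[< exists2 w : 'I_m -> E, forall i, W (w i) & indep_mod w >].
have P1 : P 1%N.
  apply/asboolP; exists (fun=> f) => // c; rewrite big_ord1 => Mc.
  apply/rowP => i; rewrite ord1 mxE; apply/eqP/negPn/negP => c0; apply: nMf.
  by rewrite -[f]scale1r -(mulVf c0) -scalerA; exact: subspaceZ.
have ubP m : P m -> (m <= n)%N.
  move=> /asboolP[w Ww iw]; rewrite leqNgt; apply/negP => nm.
  have [i|c c0 cw] := comb_span nm (e := e) (w := w); first exact: WE.
  by move/eqP: c0; apply; apply: iw; rewrite cw; exact: subspace0.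
have exP : exists m, P m by exists 1%N.
case: (ex_maxnP exP ubP) => -[|m] Pm maxm; first by have := maxm _ P1.
have /asboolP[w Ww iw] := Pm.
have coord v : W v -> exists c : 'rV[k]_m.+1, M (v - \sum_i c 0 i *: w i).
  move=> Wv; apply: contrapT => /forallNP nv.
  have /maxm : P m.+2; last by rewrite ltnn.
  apply/asboolP; exists (fun i => oapp w v (unlift ord0 i)); last exact: indep_mod_extend.
  by move=> i; case: (unlift ord0 i).
pose rep (s : E -> E) (R : 'M[k]_m.+1) := forall j, M (s (w j) - \sum_i R j i *: w i).
have rep_ex s : S s -> exists R, rep s R.
  move=> Ss; have [j|r rE] := choice (fun j => coord (s (w j)) _); first exact: SW.
  exists (\matrix_(j, i) r j 0 i) => j; under eq_bigr do rewrite mxE; exact: rE.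
have repC s t R Q : linear s -> (forall v, M v -> M (s v)) ->
    rep s R -> rep t Q -> rep (s \o t) (Q * R).
  move=> ls sMM sR tQ j /=; apply: (subspace_trans (v := s (\sum_i Q j i *: w i))) => //.
    have := sMM _ (tQ j); rewrite -[_ - \sum_i _]addrC -scaleN1r ls.
    by rewrite scaleN1r addrC.
  rewrite (linearop_comb ls).
  have -> : \sum_i (Q * R) j i *: w i = \sum_i Q j i *: \sum_l R i l *: w l.
    under [RHS]eq_bigr do rewrite scaler_sumr.
    rewrite exchange_big; apply: eq_bigr => i _; rewrite mxE scaler_suml.
    by apply: eq_bigr => l _; rewrite scalerA.
  rewrite -sumrB; apply: subspace_sum => // i _; rewrite -scalerBr; exact: subspaceZ.
have rep1 : rep id 1.
  move=> j; rewrite (bigD1 j) //= big1 => [|i /negPf ij]; last by rewrite mxE eq_sym ij scale0r.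
  by rewrite mxE eqxx scale1r addr0 subrr; exact: subspace0.
have [|R [s Ss sR]|c c0 cR] := kolchin (n := m) (S := [set R | exists2 s, S s & rep s R]).
- move=> R Q [s Ss sR] [t St tQ]; exists (t \o s); first exact: SC.
  by apply: repC => //; [exact: (Slin _ St) | move=> v; exact: SM].
- pose s1 x := s x - x.
  have ls1 : linear s1 by move=> a x y; rewrite /s1 (Slin _ Ss) scalerBr opprD addrACA.
  have s10 : s1 0 = 0 by exact: linearop0.
  have s1M v : M v -> M (s1 v) by move=> Mv; apply: subspaceB => //; exact: SM.
  have repd d : rep (iter d s1) ((R - 1) ^+ d).
    elim: d => [|d IHd]; first by rewrite expr0; exact: rep1.
    rewrite exprSr -[iter _ _]/(s1 \o iter d s1); apply: repC => // j.
    under eq_bigr do rewrite mxE scalerDl; rewrite big_split /= opprD /s1 addrACA.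
    apply: (subspaceD sM (sR j)).
    have := subspaceN sM (rep1 j); rewrite opprB addrC; congr (M (_ + _)).
    rewrite -sumrN; apply: eq_bigr => i _.
    by rewrite [X in _ = - (X *: _)]mxE scaleNr opprK.
  have [d dE] := choice (fun j => Suni _ _ Ss (WK _ (Ww j))).
  pose D := \max_j d j.
  have D0 j : iter D s1 (w j) = 0.
    rewrite -(subnK (leq_bigmax j : d j <= D)%N) iterD dE.
    by elim: (_ - _)%N => //= i ->.
  exists D; apply/row_matrixP => j; rewrite row0; apply: iw.
  under eq_bigr do rewrite mxE.
  by have := subspaceN sM (repd D j); rewrite opprB D0 subr0.
exists (\sum_j c 0 j *: w j); split.
- by apply: subspace_comb => // i; exact: WK.
- by move=> /iw cz; rewrite cz eqxx in c0.
move=> s Ss; have [R sR] := rep_ex s Ss.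
rewrite (linearop_comb (Slin _ Ss)).
have <- : \sum_j c 0 j *: (\sum_i R j i *: w i) = \sum_j c 0 j *: w j.
  rewrite -[in RHS](cR R); last by exists s.
  under eq_bigr do rewrite scaler_sumr.
  rewrite exchange_big; apply: eq_bigr => i _; rewrite mxE scaler_suml.
  by apply: eq_bigr => l _; rewrite scalerA.
rewrite -sumrB; apply: subspace_sum => // i _; rewrite -scalerBr; exact: subspaceZ.
Qed.
End FixedVector.

(** The vectors fixed by [S] modulo [M] form a subspace that [S'] preserves,
    because [S] and [S'] commute. *)
Lemma fixed_vector2 (E : lmodType k) (K M : set E) (S S' : set (E -> E)) f :
  subspace K -> subspace M -> unipotent_monoid S K -> unipotent_monoid S' K ->
  preserves S K -> preserves S' K -> preserves S M -> preserves S' M ->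
  (forall s t, S s -> S' t -> s \o t = t \o s) -> K f -> ~ M f ->
  exists w, [/\ K w, ~ M w, forall s, S s -> M (s w - w) & forall s, S' s -> M (s w - w)].
Proof.
move=> sK sM uS uS' SK SK' SM SM' SSC Kf nMf.
have [w [Kw nMw lw]] := fixed_vector sK sM uS SK SM Kf nMf.
have [_ _ Slin _ _] := uS; have [S'1 S'C S'lin S'fin S'uni] := uS'.
pose K1 := [set v | K v /\ forall s, S s -> M (s v - v)].
have sK1 : subspace K1.
  split=> [|c a b [Ka la] [Kb lb]].
    by split=> [|s /Slin/linearop0->]; rewrite ?subrr; [exact: sK.1 | exact: sM.1].
  split=> [|s Ss]; first exact: sK.2.
  rewrite (Slin _ Ss) opprD addrACA -scalerBr.
  by apply: sM.2; [exact: la | exact: lb].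
have uS1 : unipotent_monoid S' K1.
  by split=> // [v [Kv _]|s v Ss [Kv _]]; [exact: S'fin | exact: S'uni].
have S'K1 : preserves S' K1.
  move=> t v S't [Kv lv]; split=> [|s Ss]; first exact: SK'.
  rewrite -[s (t v)]/((s \o t) v) SSC // -(linearopB (S'lin _ S't)).
  by apply: SM' => //; exact: lv.
have [w' [[Kw' lw'] nMw' rw']] := fixed_vector sK1 sM uS1 S'K1 SM' (conj Kw lw) nMw.
by exists w'.
Qed.
End Matrices.

(** * Spectra in countable dimension *)

Lemma real_uncountable (R : realType) : ~ countable [set: R].
Proof.
move=> /countable_injP[f finj].
have {finj} [g gK] : exists g : nat -> R, forall x, exists n, g n = x.
  exists (fun n => xget 0 [set x | f x = n]) => x; exists (f x).
  have h : [set y | f y = f x] x by [].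
  by apply: finj; rewrite ?inE //; exact: (xgetPex 0 (ex_intro _ x h)).
(* Nested intervals [a n, a n + w n], where the one of index [n.+1] is a third of
   the previous one that does not contain [g n]. *)
pose w n : R := 3^-1 ^+ n.
have w0 n : 0 < w n by apply: exprn_gt0; rewrite invr_gt0 ltr0n.
have wS n : w n.+1 * 3 = w n by rewrite /w exprSr; field.
pose step n a := if g n < a + w n.+1 * (3 / 2) then a + w n.+1 * 2 else a.
pose fix a n := if n is m.+1 then step m (a m) else 0.
have aS n : a n <= a n.+1 /\ a n.+1 + w n.+1 <= a n + w n.
  by rewrite /= /step; have := w0 n.+1; have := wS n; case: ifP => _ *; split; lra.
have a_mono m n : (m <= n)%N -> a m <= a n /\ a n + w n <= a m + w m.
  elim: n => [|n IHn]; first by rewrite leqn0 => /eqP->.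
  rewrite leq_eqVlt => /predU1P[->|/IHn[h1 h2]] //.
  by have [h3 h4] := aS n; split; lra.
have ub n : ubound (range a) (a n + w n).
  move=> _ [m _ <-]; have := w0 n; have := w0 m.
  by have [/a_mono[? ?]|/ltnW/a_mono[? ?]] := leqP m n => *; lra.
have a_sup n : a n <= sup (range a) <= a n + w n.
  apply/andP; split; last by apply: ge_sup => //; exists (a 0%N); exists 0%N.
  apply: sup_upper_bound; last by exists n.
  by split; [exists (a 0%N); exists 0%N | exists (a 0%N + w 0%N); exact: ub].
have [n gn] := gK (sup (range a)).
have w1 := w0 n.+1; have := a_sup n.+1.
by rewrite /= /step gn; case: ifP => [?|/negbT]; rewrite -?leNgt => *; lra.
Qed.

Lemma complex_uncountable (R : realType) : ~ countable [set: R[i]].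
Proof.
move=> /countable_injP[f finj]; apply: (@real_uncountable R).
apply/countable_injP; exists (fun x => f x%:C%C) => x y _ _ fxy.
by have := finj _ _ (mem_setT _) (mem_setT _) fxy; case.
Qed.

Section CountableSpan.
Variables (k : pzRingType) (E : lmodType k) (e : nat -> E).

Definition comb_upto n : set E :=
  [set v | exists c : 'I_n -> k, v = \sum_i c i *: e i].

Definition countable_span : set E := [set v | exists n, comb_upto n v].

Lemma comb_upto_widen m n v : (m <= n)%N -> comb_upto m v -> comb_upto n v.
Proof.
move=> mn [c ->]; exists (fun i : 'I_n => if insub (val i) is Some j then c j else 0).
rewrite [RHS](eq_bigr (fun i : 'I_n => (if insub (val i) is Some j then c j else 0) *: e i)) //.
pose F i : E := (if insub i is Some j then c (j : 'I_m) else 0) *: e i.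
rewrite -[RHS]/(\sum_(i < n) F i) (eq_bigr (fun i : 'I_m => F i)); last first.
  by move=> i _; rewrite /F valK.
rewrite (big_ord_widen n F mn) big_mkcond; apply: eq_bigr => i _.
by case: ltnP => // mi; rewrite /F insubN -?leqNgt // scale0r.
Qed.

Lemma countable_span_subspace : subspace countable_span.
Proof.
split=> [|a v w [m mv] [n nw]]; first by exists 0%N, (fun=> 0); rewrite big_ord0.
have [c ->] := comb_upto_widen (leq_maxl m n) mv.
have [d ->] := comb_upto_widen (leq_maxr m n) nw.
exists (maxn m n), (fun i => a * c i + d i); rewrite scaler_sumr -big_split.
by apply: eq_bigr => i _; rewrite scalerDl scalerA.
Qed.

Lemma countable_span_gen n : countable_span (e n).
Proof.
exists n.+1, (fun i => (i == n :> nat)%:R); rewrite big_ord_recr /= eqxx scale1r.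
by rewrite big1 ?add0r // => i _; rewrite (ltn_eqF (ltn_ord i)) scale0r.
Qed.
End CountableSpan.

Section PolynomialAction.
Variables (k : comNzRingType) (E : lmodType k) (T : E -> E).
Hypothesis linT : linear T.

(** The value at [v] of the operator [p(T)]. *)
Definition pact (p : {poly k}) v := \sum_(i < size p) p`_i *: iter i T v.

Lemma pactE N (p : {poly k}) v : (size p <= N)%N -> pact p v = \sum_(i < N) p`_i *: iter i T v.
Proof.
move=> pN; rewrite /pact (big_ord_widen N (fun i => p`_i *: iter i T v) pN).
rewrite big_mkcond; apply: eq_bigr => i _; case: ltnP => // ip.
by rewrite nth_default // scale0r.
Qed.

Lemma pactD p q v : pact (p + q) v = pact p v + pact q v.
Proof.
rewrite (pactE (N := maxn (size p) (size q))) ?size_polyD //.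
rewrite (pactE (N := maxn (size p) (size q)) (p := p)) ?leq_maxl //.
rewrite (pactE (N := maxn (size p) (size q)) (p := q)) ?leq_maxr //.
by rewrite -big_split; apply: eq_bigr => i _; rewrite coefD scalerDl.
Qed.

Lemma pactZ c p v : pact (c *: p) v = c *: pact p v.
Proof.
rewrite (pactE (N := size p)) ?size_scale_leq // scaler_sumr.
by apply: eq_bigr => i _; rewrite coefZ scalerA.
Qed.

Lemma pact0 v : pact 0 v = 0.
Proof. by rewrite /pact size_poly0 big_ord0. Qed.

Lemma pact1 v : pact 1 v = v.
Proof. by rewrite /pact size_poly1 big_ord1 coef1 scale1r. Qed.

Lemma pact_sum I (r : seq I) (F : I -> {poly k}) v :
  pact (\sum_(i <- r) F i) v = \sum_(i <- r) pact (F i) v.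
Proof. by elim/big_rec2: _ => [|i x y _ <-]; [exact: pact0 | exact: pactD]. Qed.

Lemma pact_mulXr p v : pact (p * 'X) v = pact p (T v).
Proof.
rewrite (pactE (N := (size p).+1)); last first.
  by have := size_polyMleq p 'X; rewrite size_polyX addn2.
rewrite big_ord_recl coefMX scale0r add0r; apply: eq_bigr => i _.
by rewrite coefMX /= -iterSr.
Qed.

Lemma pact_linear p : linear (pact p).
Proof.
move=> c u v; rewrite scaler_sumr -big_split; apply: eq_bigr => i _.
rewrite /= scalerA mulrC -scalerA -scalerDr; congr (_ *: _).
by elim: (i : nat) => //= j ->; exact: linT.
Qed.

Lemma pact_XsubC p a v : pact (p * ('X - a%:P)) v = pact p (T v - a *: v).
Proof.
have -> : p * ('X - a%:P) = p * 'X + (- a) *: p.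
  by rewrite mulrBr [p * a%:P]mulrC mul_polyC scaleNr.
by rewrite pactD pactZ pact_mulXr [T v - _]addrC -scaleNr pact_linear addrC.
Qed.

End PolynomialAction.

Section Spectrum.
Variables (k : closedFieldType) (E : lmodType k).
Hypothesis kunc : ~ countable [set: k].

(** A countable union of finite sets is countable, so infinitely many of the [v a]
    lie in the span of one finite part of [e]. *)
Lemma uncountable_dependent (e : nat -> E) (v : k -> E) :
  (forall a, countable_span e (v a)) ->
  exists n (l : 'I_n -> k) (c : 'rV[k]_n),
    [/\ injective l, c != 0 & \sum_i c 0 i *: v (l i) = 0].
Proof.
move=> ve; pose L n := [set a | comb_upto e n (v a)].
have [n Ln] : exists n, infinite_set (L n).
  apply: contrapT => /forallNP Lfin; apply: kunc.
  have -> : [set: k] = \bigcup_(n in [set: nat]) L n.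
    by apply/seteqP; split=> // a _; have [n en] := ve a; exists n.
  apply: bigcup_countable => // n _; apply: finite_set_countable.
  exact: contrapT (Lfin n).
have [X XL nX] := infinite_set_fset n.+1 Ln.
pose l (i : 'I_n.+1) := nth 0 (finmap.enum_fset X) i.
have lX i : l i \in finmap.enum_fset X by rewrite mem_nth // (leq_trans (ltn_ord i)).
have [|i|c c0 ce] := @comb_span k E n n.+1 (fun i => e i) (fun i => v (l i)) => //.
  exact: (XL _ (lX i)).
exists n.+1, l, c; split=> // i j /eqP; rewrite nth_uniq ?finmap.fset_uniq //.
- by move=> /eqP/val_inj.
- exact: leq_trans (ltn_ord i) nX.
- exact: leq_trans (ltn_ord j) nX.
Qed.

(** [T] has a point of spectrum on [D / W]: at some scalar [a], either [v0] is not in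
    the image of [T - a] or [T - a] is not injective.  Otherwise the uncountably many
    vectors [(T - a)^-1 v0] satisfy a linear relation; clearing denominators, [p(T)]
    kills [v0] for a nonzero polynomial [p], and so does a product of injective
    factors [T - a]. *)
Lemma spectrum_mod (T : E -> E) (D W : set E) (v0 : E) (e : nat -> E) :
  linear T -> subspace D -> subspace W ->
  (forall v, D v -> D (T v)) -> (forall v, W v -> W (T v)) ->
  (forall v, D v -> countable_span e v) ->
  D v0 -> ~ W v0 ->
  (exists a, forall v, D v -> ~ W (T v - a *: v - v0)) \/
  (exists a v, [/\ D v, ~ W v & W (T v - a *: v)]).
Proof.
move=> lT sD sW DT WT De Dv0 nWv0.
apply: contrapT => /not_orP[nosp noker].
have res a : exists v, D v /\ W (T v - a *: v - v0).
  apply: contrapT => /forallNP nv; apply: nosp; exists a => v Dv Wv.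
  by apply: (nv v).
have inj a v : D v -> W (T v - a *: v) -> W v.
  by move=> Dv Wv; apply: contrapT => nWv; apply: noker; exists a, v.
have [v vE] := choice res.
have [a|n [l [c [linj c0 cv]]]] := @uncountable_dependent e v; first exact/De/(vE a).1.
pose q i : {poly k} := \prod_(j < n | j != i) ('X - (l j)%:P).
pose p := \sum_i c 0 i *: q i.
have pactW (r : {poly k}) w : W w -> W (pact T r w).
  move=> Ww; apply: subspace_sum => // i _; apply: subspaceZ => //.
  by elim: (i : nat) => //= j; exact: WT.
have Wp : W (pact T p v0).
  pose Q : {poly k} := \prod_j ('X - (l j)%:P).
  have -> : pact T p v0 = \sum_i c 0 i *: pact T (q i) v0.
    by rewrite pact_sum; apply: eq_bigr => i _; rewrite pactZ.
  have Q0 : \sum_i c 0 i *: pact T Q (v (l i)) = 0.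
    by rewrite -(linearop_comb (pact_linear lT Q)) cv (linearop0 (pact_linear lT Q)).
  rewrite -[X in W X]subr0 -[X in _ - X]Q0 -sumrB; apply: subspace_sum => // i _.
  rewrite -scalerBr; apply: subspaceZ => //.
  have -> : Q = q i * ('X - (l i)%:P) by rewrite /Q (bigD1 i) //= mulrC.
  rewrite (pact_XsubC lT) -(linearopB (pact_linear lT (q i))); apply: pactW.
  by rewrite -opprB; apply: subspaceN => //; exact: (vE (l i)).2.
have p0 : p != 0.
  have [i ci] : exists i, c 0 i != 0 by exact/rV0Pn.
  apply/eqP => /(congr1 (fun r : {poly k} => r.[l i])).
  rewrite horner0 horner_sum (bigD1 i) //= big1 => [|j ji].
    rewrite addr0 hornerZ horner_prod => /eqP; rewrite mulf_eq0 (negPf ci) /=.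
    by move=> /prodf_eq0[j ji]; rewrite hornerXsubC subr_eq0 (inj_eq linj) eq_sym (negPf ji).
  by rewrite hornerZ horner_prod (bigD1 i) 1?eq_sym //= hornerXsubC subrr mul0r mulr0.
have [rs pE] := closed_field_poly_normal p.
rewrite pE pactZ in Wp; have lp0 : lead_coef p != 0 by rewrite lead_coef_eq0.
have {Wp} := subspaceZ (lead_coef p)^-1 sW Wp; rewrite scalerA mulVf // scale1r.
elim: rs v0 Dv0 nWv0 {nosp res v vE cv p p0 pE lp0 pactW} => [|r rs IHs] u Du nWu.
  by rewrite big_nil pact1.
rewrite big_cons mulrC (pact_XsubC lT); apply: IHs.
- by apply: subspaceB => //; [exact: DT | exact: subspaceZ].
- by move=> /(inj _ _ Du).
Qed.

End Spectrum.

(** * Nullstellensatz *)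

Section ZornAbove.
Variable (T : Type).

(** Maximality among the sets [N] united with [A], so that the empty chain has the
    upper bound [N] although the empty set need not satisfy [Q]. *)
Lemma zorn_above (Q : set (set T)) (N : set T) : Q N ->
  (forall F : set (set T), F !=set0 -> F `<=` Q -> total_on F subset -> Q (\bigcup_(M in F) M)) ->
  exists M, [/\ N `<=` M, Q M & forall M', M `<=` M' -> Q M' -> M' `<=` M].
Proof.
move=> QN Qchain; have [F FQ Ftot|M [QM Mmax]] := @Zorn_bigcup _ [set A | Q (N `|` A)].
  have [->|/set0P[A0 FA0]] := eqVneq F set0; first by rewrite bigcup_set0 /= setU0.
  rewrite /=; have -> : N `|` \bigcup_(A in F) A = \bigcup_(M in [set N `|` A | A in F]) M.
    rewrite bigcup_image; apply/seteqP; split=> x.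
      by move=> [Nx|[A FA Ax]]; [exists A0 => //; left | exists A => //; right].
    by move=> [A FA [Nx|Ax]]; [left | right; exists A].
  apply: Qchain; first by exists (N `|` A0); exists A0.
  - by move=> _ [A FA <-]; exact: FQ.
  - move=> _ _ [A FA <-] [A' FA' <-]; have [AA'|AA'] := Ftot _ _ FA FA'.
      by left; exact: setUS.
    by right; exact: setUS.
exists (N `|` M); split=> // M' MM' QM'.
apply: contrapT => nM'; apply: (Mmax M'); last by rewrite /= setUidr // => x Nx; apply: MM'; left.
by split=> [x Mx|M'M]; [apply: MM'; right | apply: nM' => x /M'M; right].
Qed.

Lemma chain_pair (F : set (set T)) x y : total_on F subset ->
  (\bigcup_(M in F) M) x -> (\bigcup_(M in F) M) y -> exists M, [/\ F M, M x & M y].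
Proof.
move=> Ftot [A FA Ax] [A' FA' Ay].
by have [AA'|AA'] := Ftot _ _ FA FA'; [exists A' | exists A]; split=> //; exact: AA'.
Qed.
End ZornAbove.

Lemma subspace_chain (k : pzRingType) (E : lmodType k) (F : set (set E)) :
  F !=set0 -> total_on F subset -> (forall M, F M -> subspace M) ->
  subspace (\bigcup_(M in F) M).
Proof.
move=> [M0 FM0] Ftot sF; split=> [|c v w]; first by exists M0 => //; exact: (sF _ FM0).1.
move=> /(chain_pair Ftot)/[apply]-[M [FM Mv Mw]].
by exists M => //; exact: (sF _ FM).2.
Qed.

Section Characters.
Variables (k : closedFieldType) (X : Type).
Hypothesis kunc : ~ countable [set: k].
Local Notation F := (X -> k^o).
Variable B : set F.
Hypotheses (sB : subspace B) (B1 : B 1) (BM : forall f g, B f -> B g -> B (f * g)).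
Variable e : nat -> F.
Hypothesis Be : forall f, B f -> countable_span e f.

Definition ideal_of (N : set F) :=
  [/\ subspace N, N `<=` B & forall f g, B f -> N g -> N (f * g)].

Definition character (chi : F -> k) :=
  [/\ chi 1 = 1, forall c f g, B f -> B g -> chi (c *: f + g) = c * chi f + chi g
    & forall f g, B f -> B g -> chi (f * g) = chi f * chi g].

Lemma fct_scaleAl c (f g : F) : c *: (f * g) = (c *: f) * g.
Proof. by apply/funext => x; exact: mulrA. Qed.

Lemma linear_fct_mul (f : F) : linear (fun g : F => f * g).
Proof. by move=> c u v; rewrite mulrDr; congr (_ + _); rewrite mulrC -fct_scaleAl mulrC. Qed.

Lemma proper_ideal_maximal N : ideal_of N -> ~ N 1 ->
  exists M, [/\ N `<=` M, ideal_of M, ~ M 1 &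
    forall M', M `<=` M' -> ideal_of M' -> ~ M' 1 -> M' `<=` M].
Proof.
move=> iN nN1.
have [//|C C0 CQ Ctot|M [NM [iM nM1] Mmax]] := @zorn_above F [set M | ideal_of M /\ ~ M 1] N.
  split; last by move=> [M /CQ[]].
  split; first by apply: subspace_chain => // M /CQ[[]].
    by move=> f [M /CQ[[_ MB _] _]]; exact: MB.
  by move=> f g Bf [M CM Mg]; have [[_ _ MI] _] := CQ _ CM; exists M => //; exact: MI.
by exists M; split=> // M' MM' iM' nM'1; exact: Mmax.
Qed.

(** Let [M] be a maximal ideal.  Multiplication by [f] has a point of spectrum [a] on
    [B / M], so [f - a] is not invertible modulo [M] and lies in [M]: every function
    is a scalar modulo [M]. *)
Lemma proper_ideal_character N : ideal_of N -> ~ N 1 ->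
  exists2 chi, character chi & forall f, N f -> chi f = 0.
Proof.
move=> iN nN1; have [M [NM iM nM1 Mmax]] := proper_ideal_maximal iN nN1.
have [sM MB MI] := iM.
have Bscal (f : F) (a : k) : B f -> B (f - a *: (1 : F)) by move=> Bf; apply: subspaceB => //; exact: subspaceZ.
have mulE (f : F) (a : k) (v : F) : (f - a *: (1 : F)) * v = f * v - a *: v.
  by rewrite mulrBl -fct_scaleAl mul1r.
have scal (f : F) : B f -> exists a : k, M (f - a *: (1 : F)).
  move=> Bf; have [v Bv|v Mv|[a na]|[a [w [Bw nMw Mw]]]] :=
    spectrum_mod kunc (linear_fct_mul f) sB sM _ _ Be B1 nM1.
  - exact: BM.
  - exact: MI.
  - exists a; apply: (Mmax [set u | exists x v, [/\ M x, B v & u = x + (f - a *: (1 : F)) * v]]).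
    + by move=> x Mx; exists x, 0; rewrite mulr0 addr0; split=> //; exact: sB.1.
    + split.
      * split=> [|c u v [x [x' [Mx Bx' ->]]] [y [y' [My By' ->]]]].
          by exists 0, 0; rewrite mulr0 addr0; split=> //; [exact: sM.1 | exact: sB.1].
        exists (c *: x + y), (c *: x' + y'); split; [exact: sM.2 | exact: sB.2 |].
        by rewrite linear_fct_mul scalerDr addrACA.
      * move=> _ [x [v [Mx Bv ->]]]; apply: subspaceD => //; first exact: MB.
        by apply: BM => //; exact: Bscal.
      * move=> g _ Bg [x [v [Mx Bv ->]]]; exists (g * x), (g * v).
        by rewrite mulrDr mulrCA; split=> //; [exact: MI | exact: BM].
    + move=> [x [v [Mx Bv]]]; rewrite mulE => E1; apply: (na v Bv).
      by rewrite E1 opprD addrCA subrr addr0; exact: subspaceN.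
    + by exists 0, 1; rewrite mulr1 add0r; split=> //; exact: sM.1.
  - exists a; apply: (Mmax [set u | B u /\ M (u * w)]).
    + by move=> x Mx; split; [exact: MB | rewrite mulrC; exact: MI].
    + split.
      * split=> [|c u v [Bu Mu] [Bv Mv]].
          by split; [exact: sB.1 | rewrite mul0r; exact: sM.1].
        by split; [exact: sB.2 | rewrite mulrDl -fct_scaleAl; exact: sM.2].
      * by move=> u [].
      * by move=> g u Bg [Bu Mu]; split; [exact: BM | rewrite -mulrA; exact: MI].
    + by rewrite /= mul1r => -[].
    + by split; [exact: Bscal | rewrite mulE].
have scal_uniq (a b : k) (f : F) : M (f - a *: (1 : F)) -> M (f - b *: (1 : F)) -> a = b.
  move=> Ma Mb; apply/eqP; rewrite -subr_eq0; apply/negPn/negP => ab; apply: nM1.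
  have := subspaceB sM Mb Ma; rewrite opprB addrC addrA subrK -scalerBl => /(subspaceZ (a - b)^-1 sM).
  by rewrite scalerA mulVf // scale1r.
have [f|chi chiP] := choice (P := fun (f : F) (a : k) => B f -> M (f - a *: (1 : F))).
  have [/scal[a Ma]|nBf] := pselect (B f); first by exists a.
  by exists 0.
exists chi; last first.
  move=> f Nf; apply: (scal_uniq _ _ f); first by apply: chiP; apply/MB/NM.
  by rewrite scale0r subr0; exact: NM.
split=> [|c f g Bf Bg|f g Bf Bg].
- apply: (scal_uniq _ _ 1); first exact: chiP.
  by rewrite scale1r subrr; exact: sM.1.
- apply: (scal_uniq _ _ (c *: f + g)); first by apply/chiP/sB.2.
  rewrite scalerDl -scalerA opprD addrACA -scalerBr.
  by apply: sM.2; exact: chiP.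
- apply: (scal_uniq _ _ (f * g)); first by apply/chiP/BM.
  apply: (subspace_trans sM (v := chi g *: f)).
    have -> : f * g - chi g *: f = f * (g - chi g *: (1 : F)).
      by rewrite mulrBr [f * (_ *: _)]mulrC -fct_scaleAl mul1r.
    by apply: MI => //; exact: chiP.
  by rewrite mulrC -scalerA -scalerBr; apply: subspaceZ => //; exact: chiP.
Qed.

End Characters.

(** * Translations on the coordinate algebra *)

Section CoordinateAlgebra.
Variables (k : closedFieldType) (G : affGroup k).
Local Notation A := (coordAlg G).
Implicit Types (a b : A) (g h : G).

Fact poly_regular (p : {mpoly k[adim G]}) : (fun g => p.@[coordf g]) \in @regular k G.
Proof. by apply/regularP; exists p. Qed.
Definition polyfun p : A := CoordAlg (poly_regular p).

Lemma polyfun_surj a : exists p, a = polyfun p.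
Proof. by have /regularP[p ap] := valP a; exists p; apply: coordAlg_eqP. Qed.

Definition monfun n : A := if unpickle n is Some m then polyfun 'X_[m] else 0.

Lemma coordAlg_countable a : countable_span monfun a.
Proof.
have [p ->] := polyfun_surj a; have sS := countable_span_subspace monfun.
have -> : polyfun p = \sum_(m <- msupp p) p@_m *: polyfun 'X_[m].
  apply: coordAlg_eqP => g; rewrite sumE [LHS](_ : _ = p.@[coordf g]) // {1}[p]mpolyE.
  rewrite raddf_sum; apply: eq_bigr => m _; exact: mevalZ.
apply: subspace_sum => // m _; apply: subspaceZ => //.
by have := countable_span_gen monfun (pickle m); rewrite /monfun pickleK.
Qed.

(** Defined through the coproduct, so that the translates of [a] visibly lie in the
    span of the middle factors of [comul3 a]. *)
Definition trans h h' a : A := \sum_(u <- comul3 a) (u.1.1 h * u.2 h') *: u.1.2.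

Lemma transE h h' a x : trans h h' a x = a (h * x * h')%g.
Proof.
by rewrite sumE comul3E; apply: eq_bigr => u _; rewrite scaleE mulrAC.
Qed.

Lemma trans_linear h h' : linear (trans h h').
Proof. by move=> c a b; apply: coordAlg_eqP => x; rewrite !(transE, addE, scaleE). Qed.

Lemma transM h h' a b : trans h h' (a * b) = trans h h' a * trans h h' b.
Proof. by apply: coordAlg_eqP => x; rewrite !(transE, mulE). Qed.

Lemma trans_trans g g' h h' a : trans g g' (trans h h' a) = trans (h * g) (g' * h') a.
Proof. by apply: coordAlg_eqP => x; rewrite !transE !mulgA. Qed.

Lemma trans1 a : trans 1%g 1%g a = a.
Proof. by apply: coordAlg_eqP => x; rewrite transE mul1g mulg1. Qed.

Lemma trans_finite (S : set (A -> A)) a :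
  (forall s, S s -> exists h h', s = trans h h') -> finite_orbit S a.
Proof.
move=> ST; exists (size (comul3 a)), (fun i => (tnth (in_tuple (comul3 a)) i).1.2).
move=> _ /ST[h [h' ->]]; rewrite /trans big_tnth.
by exists (fun i => (tnth (in_tuple (comul3 a)) i).1.1 h * (tnth (in_tuple (comul3 a)) i).2 h').
Qed.

Hypothesis unipG : unipotent G.

Lemma trans_unipotentr g a : unipotent_at (trans 1%g g) a.
Proof.
have [N aN] := unipG g a; exists N; apply: coordAlg_eqP => x; rewrite zeroE -[RHS](aN x).
elim: N {aN} x => //= N IHN x.
by rewrite subE transE mul1g !IHN.
Qed.

Fact inv_regular a : (fun g => a g^-1%g) \in @regular k G.
Proof.
have /regularP[p ap] := valP a; have [q qE] := choice (@coordf_inv k G).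
apply/regularP; exists (p \mPo [tuple q i | i < adim G]) => g.
rewrite comp_mpoly_meval ap; apply: meval_eq => i.
by rewrite tnth_map tnth_ord_tuple qE.
Qed.
Definition antipode a : A := CoordAlg (inv_regular a).

(** Inversion exchanges the left translation by [g] and the right one by its
    inverse. *)
Lemma trans_unipotentl g a : unipotent_at (trans g 1%g) a.
Proof.
have [N aN] := trans_unipotentr g^-1%g (antipode a); exists N.
apply: coordAlg_eqP => x; rewrite zeroE.
rewrite -[RHS]/((0 : A) x^-1%g) -aN.
elim: N {aN} x => [|N IHN] x; first by rewrite /= /antipode /regfun /= invgK.
by rewrite !iterS !subE !transE mul1g mulg1 IHN IHN invgM.
Qed.

End CoordinateAlgebra.

Section Invariants.
Variables (k : closedFieldType) (G : affGroup k) (H : closed_subgroup G).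
Local Notation A := (coordAlg G).

Definition stable (I : set A) := forall h h' a,
  (H : set G) h -> (H : set G) h' -> I a -> I (trans h h' a).

Definition invariant_mod (I : set A) a := forall h h',
  (H : set G) h -> (H : set G) h' -> I (trans h h' a - a).

Lemma invariant_modP (I : set A) a : subspace I -> stable I ->
  (forall h, (H : set G) h -> I (trans h 1%g a - a)) ->
  (forall h, (H : set G) h -> I (trans 1%g h a - a)) -> invariant_mod I a.
Proof.
move=> sI stI la ra h h' Hh Hh'.
apply: (subspace_trans (v := trans h 1%g a)) => //; last exact: la.
have := stI h 1%g _ Hh (subgroup1 H) (ra h' Hh').
by rewrite (linearopB (trans_linear h 1%g)) trans_trans !mul1g.
Qed.

Hypotheses (k0 : [pchar k] =i pred0) (unipG : unipotent G).

Lemma exists_invariant_mod (K M : set A) f : subspace K -> subspace M ->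
  stable K -> stable M -> K f -> ~ M f ->
  exists w, [/\ K w, ~ M w & invariant_mod M w].
Proof.
move=> sK sM stK stM Kf nMf; have H1 := subgroup1 H.
pose SL := [set trans h 1%g | h in (H : set G)] : set (A -> A).
pose SR := [set trans 1%g h | h in (H : set G)] : set (A -> A).
have trans11 : trans 1%g 1%g = id :> (A -> A) by apply/funext => a; exact: trans1.
have uL : unipotent_monoid SL K.
  split=> [|_ _ [g Hg <-] [h Hh <-]|_ [h _ <-]|a _|_ a [h _ <-] _].
  - by exists 1%g.
  - exists (h * g)%g; first exact: subgroupM.
    by apply/funext => a /=; rewrite trans_trans mulg1.
  - exact: trans_linear.
  - by apply: trans_finite => _ [h _ <-]; exists h, 1%g.
  - exact: trans_unipotentl.
have uR : unipotent_monoid SR K.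
  split=> [|_ _ [g Hg <-] [h Hh <-]|_ [h _ <-]|a _|_ a [h _ <-] _].
  - by exists 1%g.
  - exists (g * h)%g; first exact: subgroupM.
    by apply/funext => a /=; rewrite trans_trans mulg1.
  - exact: trans_linear.
  - by apply: trans_finite => _ [h _ <-]; exists 1%g, h.
  - exact: trans_unipotentr.
have [|||||w [Kw nMw lw rw]] := fixed_vector2 k0 sK sM uL uR _ _ _ _ _ Kf nMf.
- by move=> _ a [h Hh <-]; exact: stK.
- by move=> _ a [h Hh <-]; exact: stK.
- by move=> _ a [h Hh <-]; exact: stM.
- by move=> _ a [h Hh <-]; exact: stM.
- move=> _ _ [g _ <-] [h _ <-]; apply/funext => a /=.
  by rewrite !trans_trans !mul1g !mulg1.
exists w; split=> //; apply: invariant_modP => // h Hh; last by apply: rw; exists h.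
by apply: lw; exists h.
Qed.

End Invariants.

Section Points.
Variables (k : closedFieldType) (G : affGroup k) (X : Type) (B : set (X -> k^o)).
Local Notation A := (coordAlg G).

Lemma mpoly_eval_morph n (phi : {mpoly k[n]} -> k) :
  phi 1 = 1 -> (forall c p q, phi (c *: p + q) = c * phi p + phi q) ->
  (forall p q, phi (p * q) = phi p * phi q) ->
  forall p, phi p = p.@[fun i => phi 'X_i].
Proof.
move=> phi1 philin phiM p.
have phi0 : phi 0 = 0 by have := philin (-1) 0 0; rewrite scaler0 addr0 mulN1r addNr.
have phiX m : phi 'X_[m] = \prod_i phi 'X_i ^+ m i.
  rewrite mpolyXE_id; elim/big_rec2: _ => [|i x y _ <-]; first exact: phi1.
  rewrite phiM; congr (_ * _); elim: (m i) => [|d IHd]; first by rewrite !expr0.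
  by rewrite !exprS phiM IHd.
rewrite mevalE {1}[p]mpolyE; elim/big_rec2: _ => [|m x y _ <-] //.
by rewrite philin phiX.
Qed.

(** A character restricts along [iota] to a character of the coordinate algebra
    of [G]; the images of the coordinates satisfy the equations of [G], hence are
    the coordinates of a point. *)
Lemma character_point (chi : (X -> k^o) -> k) (iota : X -> G) :
  character B chi -> (forall a : A, B (fun x => a (iota x))) ->
  exists g, forall a : A, chi (fun x => a (iota x)) = a g.
Proof.
move=> [chi1 chilin chiM] Biota.
pose phi (p : {mpoly k[adim G]}) := chi (fun x => polyfun p (iota x)).
have phiE p : phi p = p.@[fun i => phi 'X_i].
  apply: mpoly_eval_morph => [|c p' q|p' q].
  - by rewrite -[RHS]chi1; congr chi; apply/funext => x; exact: meval1.
  - rewrite -chilin //; congr chi; apply/funext => x.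
    by rewrite /polyfun /regfun mevalD mevalZ.
  - rewrite -chiM //; congr chi; apply/funext => x; exact: mevalM.
have [S rS] := coordf_closed G.
have /= [g _ gE] : range (@coordf k G) (fun i => phi 'X_i).
  rewrite rS => p Sp; rewrite -phiE.
  have -> : phi p = chi 0.
    rewrite /phi; congr chi; apply/funext => x; rewrite /polyfun /regfun.
    by have : range (@coordf k G) (coordf (iota x)) by []; rewrite rS; exact.
  have := chilin (-1) _ _ (Biota 0) (Biota 0).
  by rewrite mulN1r addNr scaleN1r addNr.
exists g => a; have [p ->] := polyfun_surj a.
by rewrite -/(phi p) phiE -gE.
Qed.
End Points.

(** * Stable ideals and double cosets *)

Section StableIdeals.
Variables (k : closedFieldType) (G : affGroup k).
Local Notation A := (coordAlg G).

Definition coord_ideal (I : set A) := subspace I /\ forall a b, I b -> I (a * b).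

Hypothesis kunc : ~ countable [set: k].

(** Weak Nullstellensatz for [O(G)]. *)
Lemma coord_ideal_zero (I : set A) : coord_ideal I -> ~ I 1 ->
  exists g, forall a, I a -> a g = 0.
Proof.
move=> [sI mI] nI1; pose im (a : A) : G -> k^o := regfun a.
have sub_im (W : set A) : subspace W -> subspace [set im a | a in W].
  move=> sW; split=> [|c _ _ [a Wa <-] [b Wb <-]]; first by exists 0 => //; exact: sW.1.
  by exists (c *: a + b) => //; exact: sW.2.
pose B := [set im a | a in setT].
have sT : subspace (setT : set A) by split.
have BM f g : B f -> B g -> B (f * g) by move=> [a _ <-] [b _ <-]; exists (a * b).
have Bc f : B f -> countable_span (fun n => im (@monfun k G n)) f.
  move=> [a _ <-]; have [n [c ac]] := coordAlg_countable a; exists n, c.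
  by rewrite ac; elim/big_rec2: _ => // i x y _ <-.
have iN : ideal_of B [set im a | a in I].
  split=> [|_ [a Ia <-]|_ _ [a _ <-] [b Ib <-]]; first exact: sub_im; first by exists a.
  by exists (a * b) => //; exact: mI.
have [||chi chiP chi0] := proper_ideal_character kunc (sub_im _ sT) _ BM Bc iN.
- by exists 1.
- move=> [a Ia a1]; apply: nI1; have <- // : a = 1.
  by apply: coordAlg_eqP => g; exact: (congr1 (fun f => f g) a1).
have [a|g gE] := character_point (iota := id) chiP; first by exists a.
by exists g => a Ia; rewrite -gE; apply: chi0; exists a.
Qed.

Variable H : closed_subgroup G.

Definition stable_ideal (I : set A) := coord_ideal I /\ stable H I.

Lemma double_coset_inhabited (Z : double_coset H) : exists z, (Z : set G) z.
Proof.
have [g ->] := dcsetP Z; exists g; exists 1%g; first exact: subgroup1.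
by exists 1%g; [exact: subgroup1 | rewrite mul1g mulg1].
Qed.

Lemma double_coset_rep (Z : double_coset H) z : (Z : set G) z ->
  (Z : set G) = [set (h * z * h')%g | h in (H : set G) & h' in (H : set G)].
Proof.
move=> Zz; apply/seteqP; split=> [x|_ [h Hh [h' Hh' <-]]]; last exact: double_coset_stable.
have [g ZE] := dcsetP Z; move: Zz; rewrite ZE => -[a Ha [b Hb <-]] [c Hc [d Hd <-]].
exists (c * a^-1)%g; first by apply: subgroupM => //; exact: subgroupV.
exists (b^-1 * d)%g; first by apply: subgroupM => //; exact: subgroupV.
by rewrite !mulgA mulgVK mulgK.
Qed.

Lemma double_coset_meet (Z Z' : double_coset H) z :
  (Z : set G) z -> (Z' : set G) z -> Z = Z'.
Proof.
move=> Zz Z'z; have : (Z : set G) = (Z' : set G).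
  by rewrite (double_coset_rep Zz) (double_coset_rep Z'z).
case: Z Z' {Zz Z'z} => [Z Zp] [Z' Z'p] /= ZZ'; case: _ / ZZ' in Z'p *.
by congr DoubleCoset; exact: Prop_irrelevance.
Qed.

Lemma vanishing_stable_ideal (Z : double_coset H) : stable_ideal (vanishing Z).
Proof.
split; last first.
  by move=> h h' a Hh Hh' Za z Zz; rewrite transE; apply: Za; exact: double_coset_stable.
split=> [|a b Zb z Zz]; last by rewrite mulE Zb ?mulr0.
split=> [z _|c a b Za Zb z Zz]; first exact: zeroE.
by rewrite addE scaleE Za // Zb // mulr0 addr0.
Qed.

Hypotheses (k0 : [pchar k] =i pred0) (unipG : unipotent G).

(** A larger stable ideal contains a function that is invariant but not zero on
    [Z]; it is constant there since [Z] is one orbit. *)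
Lemma vanishing_maximal (Z : double_coset H) (K : set A) : stable_ideal K ->
  vanishing Z `<=` K -> ~ K 1 -> K `<=` vanishing Z.
Proof.
move=> [[sK mK] stK] ZK nK1 f Kf; apply: contrapT => nZf.
have [[sZ mZ] stZ] := vanishing_stable_ideal Z.
have [w [Kw nZw wZ]] := exists_invariant_mod k0 unipG sK sZ stK stZ Kf nZf.
have [z0 Zz0] := double_coset_inhabited Z.
have Zwc : vanishing Z (w - w z0 *: 1).
  move=> z; rewrite (double_coset_rep Zz0) => -[h Hh [h' Hh' <-]].
  by have := wZ h h' Hh Hh' z0 Zz0; rewrite !subE transE scaleE oneE mulr1.
have c0 : w z0 != 0.
  by apply/eqP => c0; apply: nZw; rewrite c0 scale0r subr0 in Zwc.
apply: nK1; have := subspaceB sK Kw (ZK _ Zwc).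
rewrite opprB addrC subrK => /(subspaceZ (w z0)^-1 sK).
by rewrite scalerA mulVf // scale1r.
Qed.

End StableIdeals.

(** * Double cosets are closed *)

Section ClosedOrbits.
Variables (k : closedFieldType) (G : affGroup k) (H : closed_subgroup G).
Hypotheses (kunc : ~ countable [set: k]) (k0 : [pchar k] =i pred0).
Hypothesis unipG : unipotent G.
Local Notation A := (coordAlg G).
Local Notation HG := (subgroup_affGroup H).
Local Notation X := (HG * HG)%type.
Local Notation F := (X -> k^o).

Definition tens (a b : A) : F := fun x => a (sgval x.1) * b (sgval x.2).

(** [O(H x H)], as an algebra of functions. *)
Definition coordHH : set F := lspan [set tens ab.1 ab.2 | ab in [set: A * A]].

Lemma coordHH_tens a b : coordHH (tens a b).
Proof. by apply: sub_lspan; exists (a, b). Qed.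

Lemma coordHH_subspace : subspace coordHH. Proof. exact: lspan_subspace. Qed.

Lemma coordHH_ind (P : set F) : subspace P -> (forall a b, P (tens a b)) -> coordHH `<=` P.
Proof. by move=> sP Pt; apply: lspan_min => // _ [ab _ <-]. Qed.

Lemma coordHH1 : coordHH 1.
Proof.
have -> : 1 = tens 1 1 by apply/funext => x; rewrite /tens !oneE mulr1.
exact: coordHH_tens.
Qed.

Lemma coordHHM f g : coordHH f -> coordHH g -> coordHH (f * g).
Proof.
have sB := coordHH_subspace; move=> Bf Bg; move: f Bf; apply: coordHH_ind => [|a b].
  split=> [|c u v /= Bu Bv] /=; first by rewrite mul0r; exact: sB.1.
  by rewrite mulrDl -fct_scaleAl; exact: sB.2.
move: g Bg; apply: coordHH_ind => [|c d].
  split=> [|s u v /= Bu Bv] /=; first by rewrite mulr0; exact: sB.1.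
  by rewrite linear_fct_mul; exact: sB.2.
have -> : tens a b * tens c d = tens (a * c) (b * d).
  by apply/funext => x; rewrite /tens !mulE; exact: mulrACA.
exact: coordHH_tens.
Qed.

Lemma tens_linearl b : linear (tens^~ b).
Proof.
move=> c a a'; apply/funext => x; rewrite /tens addE scaleE mulrDl -mulrA.
by [].
Qed.

Lemma tens_linearr a : linear (tens a).
Proof.
move=> c b b'; apply/funext => x; rewrite /tens addE scaleE mulrDr mulrCA.
by [].
Qed.

Lemma coordHH_countable : exists e, forall f, coordHH f -> countable_span e f.
Proof.
pose e n : F := if unpickle n is Some ij then tens (@monfun k G ij.1) (@monfun k G ij.2) else 0.
exists e; have sS := countable_span_subspace e; apply: coordHH_ind => // a b.
have [m [c ->]] := coordAlg_countable a; rewrite (linearop_comb (tens_linearl b)).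
apply: subspace_comb => // i; have [n [d ->]] := coordAlg_countable b.
rewrite (linearop_comb (tens_linearr _)); apply: subspace_comb => // j.
by have := countable_span_gen e (pickle ((i : nat), (j : nat))); rewrite /e pickleK.
Qed.

Definition ltr (t : HG) (f : F) : F := fun x => f (t * x.1, x.2)%g.
Definition rtr (t : HG) (f : F) : F := fun x => f (x.1, x.2 * t)%g.

Lemma ltr_linear t : linear (ltr t). Proof. by []. Qed.
Lemma rtr_linear t : linear (rtr t). Proof. by []. Qed.

Lemma ltr_tens t a b : ltr t (tens a b) = tens (trans (sgval t) 1%g a) b.
Proof. by apply/funext => x; rewrite /ltr /tens transE mulg1. Qed.

Lemma rtr_tens t a b : rtr t (tens a b) = tens a (trans 1%g (sgval t) b).
Proof. by apply/funext => x; rewrite /rtr /tens transE mul1g. Qed.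

Lemma iter_sub_linear (E E' : lmodType k) (s : E -> E) (s' : E' -> E') (f : E -> E') d v :
  linear f -> (forall v, s' (f v) = f (s v)) ->
  iter d (fun x => s' x - x) (f v) = f (iter d (fun x => s x - x) v).
Proof.
by move=> lf sf; elim: d => //= d ->; rewrite sf -(linearopB lf).
Qed.

Lemma finite_orbit_linear (E E' : lmodType k) (S : set (E -> E)) (S' : set (E' -> E'))
    (f : E -> E') v : linear f ->
  (forall s', S' s' -> exists2 s, S s & s' (f v) = f (s v)) ->
  finite_orbit S v -> finite_orbit S' (f v).
Proof.
move=> lf SS' [n [e eE]]; exists n, (fun i => f (e i)) => s' /SS'[s /eE[c cE] ->].
by exists c; rewrite cE (linearop_comb lf).
Qed.

Lemma ltr_unipotent : unipotent_monoid (range ltr) coordHH.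
Proof.
split=> [|_ _ [t _ <-] [t' _ <-]|_ [t _ <-]|f|_ f [t _ <-]].
- by exists 1%g => //; apply/funext => f; apply/funext => -[x y]; rewrite /ltr /= mul1g.
- exists (t' * t)%g => //; apply/funext => f; apply/funext => x.
  by rewrite /ltr /= mulgA.
- exact: ltr_linear.
- move: f; apply: coordHH_ind => [|a b].
    by apply: finite_orbit_subspace => _ [t _ <-]; exact: ltr_linear.
  apply: (finite_orbit_linear (S := range (fun h : HG => trans (sgval h) 1%g)) (tens_linearl b)).
    move=> _ [t _ <-]; exists (trans (sgval t) 1%g); [by exists t | exact: ltr_tens].
  by apply: trans_finite => _ [t _ <-]; exists (sgval t), 1%g.
- move: f; apply: coordHH_ind => [|a b]; first by apply: unipotent_at_subspace; exact: ltr_linear.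
  have [d ad] := trans_unipotentl unipG (sgval t) a; exists d.
  rewrite (iter_sub_linear (s := trans (sgval t) 1%g) _ _ (tens_linearl b)).
    by rewrite ad (linearop0 (tens_linearl b)).
  by move=> a'; exact: ltr_tens.
Qed.

Lemma rtr_unipotent : unipotent_monoid (range rtr) coordHH.
Proof.
split=> [|_ _ [t _ <-] [t' _ <-]|_ [t _ <-]|f|_ f [t _ <-]].
- by exists 1%g => //; apply/funext => f; apply/funext => -[x y]; rewrite /rtr /= mulg1.
- exists (t * t')%g => //; apply/funext => f; apply/funext => x.
  by rewrite /rtr /= mulgA.
- exact: rtr_linear.
- move: f; apply: coordHH_ind => [|a b].
    by apply: finite_orbit_subspace => _ [t _ <-]; exact: rtr_linear.
  apply: (finite_orbit_linear (S := range (fun h : HG => trans 1%g (sgval h))) (tens_linearr a)).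
    move=> _ [t _ <-]; exists (trans 1%g (sgval t)); [by exists t | exact: rtr_tens].
  by apply: trans_finite => _ [t _ <-]; exists 1%g, (sgval t).
- move: f; apply: coordHH_ind => [|a b]; first by apply: unipotent_at_subspace; exact: rtr_linear.
  have [d bd] := trans_unipotentr unipG (sgval t) b; exists d.
  rewrite (iter_sub_linear (s := trans 1%g (sgval t)) _ _ (tens_linearr a)).
    by rewrite bd (linearop0 (tens_linearr a)).
  by move=> b'; exact: rtr_tens.
Qed.

(** A character of [O(H x H)] is a point: its components are points of [G] at
    which the equations of [H] vanish. *)
Lemma coordHH_character chi : character coordHH chi ->
  exists x : X, forall f, coordHH f -> chi f = f x.
Proof.
move=> chiP; have [chi1 chilin chiM] := chiP.
have mkpt (iota : X -> HG) : (forall a : A, coordHH (fun x => a (sgval (iota x)))) ->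
    exists h : HG, forall a : A, chi (fun x => a (sgval (iota x))) = a (sgval h).
  move=> Bi; have [g gE] := character_point chiP Bi.
  suff Hg : (H : set G) g.
    have gH : g \in subgroup_pred H by exact/subgroup_predP.
    by exists (SubgroupPoint gH).
  have [S HS] := subgroup_closed H.
  have : [set coordf h | h in (H : set G)] (coordf g).
    rewrite HS => p Sp; rewrite -[LHS]/(polyfun p g) -gE.
    have -> : (fun x => polyfun p (sgval (iota x))) = 0 :> F.
      apply/funext => x; rewrite /polyfun /regfun.
      have : [set coordf h | h in (H : set G)] (coordf (sgval (iota x))).
        by exists (sgval (iota x)) => //; exact/subgroup_predP/valP.
      by rewrite HS; exact.
    have := chilin (-1) _ _ coordHH1 coordHH1.
    by rewrite chi1 mulN1r addNr scaleN1r addNr.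
  by move=> [h Hh /coordf_inj <-].
have [a|h1 h1E] := mkpt fst.
  have -> : (fun x => a (sgval x.1)) = tens a 1 by apply/funext => x; rewrite /tens oneE mulr1.
  exact: coordHH_tens.
have [a|h2 h2E] := mkpt snd.
  have -> : (fun x => a (sgval x.2)) = tens 1 a by apply/funext => x; rewrite /tens oneE mul1r.
  exact: coordHH_tens.
exists (h1, h2) => f Bf; have sB := coordHH_subspace.
suff [] : [set f | coordHH f /\ chi f = f (h1, h2)] f by [].
move: f Bf; apply: coordHH_ind => [|a b].
  split=> [|c u v [Bu u0] [Bv v0]].
    split; first exact: sB.1.
    have := chilin (-1) _ _ coordHH1 coordHH1.
    by rewrite chi1 mulN1r addNr scaleN1r addNr.
  by split; [exact: sB.2 | rewrite chilin // u0 v0].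
split; first exact: coordHH_tens.
have -> : tens a b = tens a 1 * tens 1 b.
  by apply/funext => x; rewrite [RHS]/(tens a 1 x * tens 1 b x) /tens !oneE mulr1 mul1r.
rewrite chiM; [|exact: coordHH_tens..].
have := h1E a; have := h2E b.
have -> : (fun x => b (sgval x.2)) = tens 1 b by apply/funext => x; rewrite /tens oneE mul1r.
have -> : (fun x => a (sgval x.1)) = tens a 1 by apply/funext => x; rewrite /tens oneE mulr1.
by move=> -> ->; rewrite [RHS]/(tens a 1 _ * tens 1 b _) /tens !oneE mulr1 mul1r.
Qed.

Section Orbit.
Variables (Z : double_coset H) (g : G).
Hypothesis Zg : (Z : set G) g.

(** The pullback along the orbit map [(h, h') |-> h g h']. *)
Definition orbmap (r : A) : F := fun x => r (sgval x.1 * g * sgval x.2)%g.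

Lemma orbmap_linear : linear orbmap. Proof. by []. Qed.
Lemma orbmapM r s : orbmap (r * s) = orbmap r * orbmap s. Proof. by []. Qed.
Lemma orbmap1 : orbmap 1 = 1. Proof. by []. Qed.

Lemma orbmap_coordHH r : coordHH (orbmap r).
Proof.
have -> : orbmap r = \sum_(u <- comul3 r) (u.1.2 g : k) *: tens u.1.1 u.2.
  apply/funext => x; rewrite fct_sumE /orbmap comul3E; apply: eq_bigr => u _.
  by rewrite mulrAC mulrC.
have sB := coordHH_subspace.
by apply: (subspace_sum _ sB) => u _; apply: (subspaceZ _ sB); exact: coordHH_tens.
Qed.

Lemma orbmap_ltr t r : ltr t (orbmap r) = orbmap (trans (sgval t) 1%g r).
Proof. by apply/funext => x; rewrite /ltr /orbmap transE mulg1 !mulgA. Qed.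

Lemma orbmap_rtr t r : rtr t (orbmap r) = orbmap (trans 1%g (sgval t) r).
Proof. by apply/funext => x; rewrite /rtr /orbmap transE mul1g !mulgA. Qed.

Lemma orbmap_eq0 r : orbmap r = 0 <-> vanishing Z r.
Proof.
split=> [r0 z|Zr].
  rewrite (double_coset_rep Zg) => -[h Hh [h' Hh' <-]].
  have hH : h \in subgroup_pred H by exact/subgroup_predP.
  have h'H : h' \in subgroup_pred H by exact/subgroup_predP.
  exact: (congr1 (fun f : F => f (SubgroupPoint hH, SubgroupPoint h'H)) r0).
apply/funext => x; rewrite /orbmap [LHS]Zr //.
apply: double_coset_stable => //; exact/subgroup_predP/(valP _).
Qed.

Definition orb_submodule (M : set F) := [/\ subspace M, M `<=` coordHH,
  forall r f, M f -> M (orbmap r * f), preserves (range ltr) M & preserves (range rtr) M].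

Variable x : G.
Hypothesis xZ : forall r, vanishing Z r -> r x = 0.

(** The submodule [m_x M], where [m_x] is the maximal ideal of [x]. *)
Definition maxideal_mul (M : set F) : set F :=
  lspan [set f | exists (r : A) (m : F), [/\ r x = 0, M m & f = orbmap r * m]].

Lemma maxideal_mul_subspace M : subspace (maxideal_mul M).
Proof. exact: lspan_subspace. Qed.

Lemma maxideal_mul_ind (M P : set F) : subspace P ->
  (forall (r : A) m, r x = 0 -> M m -> P (orbmap r * m)) -> maxideal_mul M `<=` P.
Proof. by move=> sP Pm; apply: lspan_min => // _ [r [m [rx Mm ->]]]; exact: Pm. Qed.

Lemma maxideal_mul_mem (M : set F) (r : A) m : r x = 0 -> M m -> maxideal_mul M (orbmap r * m).
Proof. by move=> rx Mm; apply: sub_lspan; exists r, m. Qed.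

Lemma maxideal_mulS (M M' : set F) : M `<=` M' -> maxideal_mul M `<=` maxideal_mul M'.
Proof.
move=> MM'; apply: maxideal_mul_ind => [|r m rx Mm]; first exact: maxideal_mul_subspace.
by apply: maxideal_mul_mem => //; exact: MM'.
Qed.

(** If [1] were the pullback of [r] with [r x = 0], then [r - 1] would vanish on [Z]
    but not at [x]. *)
Lemma maxideal_mul_range : ~ maxideal_mul (range orbmap) 1.
Proof.
move=> /(@maxideal_mul_ind _ [set orbmap r | r in [set r : A | r x = 0]])[||r rx r1].
- split=> [|c _ _ [r rx <-] [s sx <-]]; first by exists 0 => //; exact: zeroE.
  by exists (c *: r + s) => //=; rewrite addE scaleE rx sx mulr0 addr0.
- by move=> r _ rx [s _ <-]; exists (r * s) => //=; rewrite mulE rx mul0r.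
have /orbmap_eq0/xZ : orbmap (r - 1) = 0.
  by rewrite (linearopB orbmap_linear) r1 orbmap1 subrr.
by rewrite subE rx oneE sub0r => /eqP; rewrite oppr_eq0 oner_eq0.
Qed.

(** Adjoining to [M] an element [b] fixed modulo [M] adds a free summand, because
    its annihilator modulo [M] is a stable ideal; hence [1] stays outside [m_x M]. *)
Lemma maxideal_mul_extend (M : set F) b : orb_submodule M -> M 1 -> ~ M b -> coordHH b ->
  (forall s, range ltr s -> M (s b - b)) -> (forall s, range rtr s -> M (s b - b)) ->
  ~ maxideal_mul M 1 ->
  let M' := [set f : F | exists (m : F) (r : A), M m /\ f = m + orbmap r * b] in
  orb_submodule M' /\ ~ maxideal_mul M' 1.
Proof.
move=> [sM MB Mmul lM rM] M1 nMb Bb lb rb nJ M'.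
have sMb : subspace [set f : F | exists (m : F) (r : A), M m /\ f = m + orbmap r * b].
  split=> [|c _ _ [m [r [Mm ->]]] [n [s [Mn ->]]]].
    by exists 0, 0; rewrite (linearop0 orbmap_linear) mul0r addr0; split=> //; exact: sM.1.
  exists (c *: m + n), (c *: r + s); split; first exact: sM.2.
  by rewrite orbmap_linear mulrDl -fct_scaleAl scalerDr addrACA.
split.
  split=> // [_ [m [r [Mm ->]]]|s _ [m [r [Mm ->]]]|_ _ [t _ <-] [m [r [Mm ->]]]|_ _ [t _ <-] [m [r [Mm ->]]]].
  - apply: (subspaceD coordHH_subspace (MB _ Mm)).
    by apply: coordHHM => //; exact: orbmap_coordHH.
  - exists (orbmap s * m), (s * r); split; first exact: Mmul.
    by rewrite mulrDr mulrA orbmapM.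
  - exists (ltr t m + orbmap (trans (sgval t) 1%g r) * (ltr t b - b)), (trans (sgval t) 1%g r).
    split; first by apply: (subspaceD sM) => //; [apply: lM => //; exists t | apply/Mmul/lb; exists t].
    by rewrite -addrA -mulrDr subrK -orbmap_ltr.
  - exists (rtr t m + orbmap (trans 1%g (sgval t) r) * (rtr t b - b)), (trans 1%g (sgval t) r).
    split; first by apply: (subspaceD sM) => //; [apply: rM => //; exists t | apply/Mmul/rb; exists t].
    by rewrite -addrA -mulrDr subrK -orbmap_rtr.
move=> /(@maxideal_mul_ind _ [set f : F | exists (v : F) (q : A), maxideal_mul M v /\ f = v + orbmap q * b])[].
- have sJ := maxideal_mul_subspace M.
  split=> [|c _ _ [m [r [Mm ->]]] [n [s [Mn ->]]]].
    by exists 0, 0; rewrite (linearop0 orbmap_linear) mul0r addr0; split=> //; exact: sJ.1.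
  exists (c *: m + n), (c *: r + s); split; first exact: sJ.2.
  by rewrite orbmap_linear mulrDl -fct_scaleAl scalerDr addrACA.
- move=> r _ rx [m [s [Mm ->]]]; exists (orbmap r * m), (r * s).
  by rewrite mulrDr mulrA orbmapM; split=> //; exact: maxideal_mul_mem.
move=> v [q [Jv E1]].
have Mv : M v by move: v Jv {E1}; apply: maxideal_mul_ind => // r m _; exact: Mmul.
pose Q : set A := [set q | M (orbmap q * b)].
have Qq : Q q.
  rewrite /Q /=; have -> : orbmap q * b = 1 - v by rewrite E1 addrC addKr.
  exact: (subspaceB sM).
have stQ : stable_ideal H Q.
  split; first split.
  - split=> [|c r s Qr Qs]; first by rewrite /Q /= (linearop0 orbmap_linear) mul0r; exact: sM.1.
    by rewrite /Q /= orbmap_linear mulrDl -fct_scaleAl; exact: sM.2.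
  - by move=> r s Qs; rewrite /Q /= orbmapM -mulrA; exact: Mmul.
  have stl (t : HG) r : Q r -> Q (trans (sgval t) 1%g r).
    move=> Qr; rewrite /Q /= -orbmap_ltr.
    have -> : ltr t (orbmap r) * b = ltr t (orbmap r * b) - ltr t (orbmap r) * (ltr t b - b).
      by rewrite mulrBr opprB addrC subrK.
    apply: (subspaceB sM) => //; first by apply: lM => //; exists t.
    by rewrite orbmap_ltr; apply/Mmul/lb; exists t.
  have str (t : HG) r : Q r -> Q (trans 1%g (sgval t) r).
    move=> Qr; rewrite /Q /= -orbmap_rtr.
    have -> : rtr t (orbmap r) * b = rtr t (orbmap r * b) - rtr t (orbmap r) * (rtr t b - b).
      by rewrite mulrBr opprB addrC subrK.
    apply: (subspaceB sM) => //; first by apply: rM => //; exists t.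
    by rewrite orbmap_rtr; apply/Mmul/rb; exists t.
  move=> h h' r Hh Hh' Qr.
  have hH : h \in subgroup_pred H by exact/subgroup_predP.
  have h'H : h' \in subgroup_pred H by exact/subgroup_predP.
  have := stl (SubgroupPoint hH : HG) _ (str (SubgroupPoint h'H : HG) _ Qr).
  by rewrite trans_trans /= !mul1g.
have /orbmap_eq0 q0 : vanishing Z q.
  apply: (vanishing_maximal k0 unipG stQ) => // [r /orbmap_eq0 r0|].
    by rewrite /Q /= r0 mul0r; exact: sM.1.
  by rewrite /Q /= orbmap1 mul1r.
by rewrite q0 mul0r addr0 in E1; apply: nJ; rewrite E1.
Qed.

Lemma maxideal_mul_chain (C : set (set F)) : C !=set0 -> total_on C subset ->
  maxideal_mul (\bigcup_(M in C) M) `<=` \bigcup_(M in C) maxideal_mul M.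
Proof.
move=> [M0 CM0] Ctot; apply: maxideal_mul_ind => [|r m rx [M CM Mm]]; last first.
  by exists M => //; exact: maxideal_mul_mem.
rewrite -(bigcup_image C maxideal_mul id); apply: subspace_chain.
- by exists (maxideal_mul M0); exists M0.
- move=> _ _ [M CM <-] [M' CM' <-].
  by have [/maxideal_mulS|/maxideal_mulS] := Ctot _ _ CM CM'; [left | right].
- by move=> _ [M _ <-]; exact: maxideal_mul_subspace.
Qed.

(** A maximal submodule [M] with [1] outside [m_x M] is all of [O(H x H)], since
    otherwise an element fixed modulo [M] could be adjoined. *)
Lemma maxideal_mul_coordHH : ~ maxideal_mul coordHH 1.
Proof.
have sN : orb_submodule (range orbmap).
  split=> [|_ [r _ <-]|s _ [r _ <-]|_ _ [t _ <-] [r _ <-]|_ _ [t _ <-] [r _ <-]].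
  - split=> [|c _ _ [r _ <-] [s _ <-]]; first by exists 0.
    by exists (c *: r + s).
  - exact: orbmap_coordHH.
  - by exists (s * r).
  - by rewrite orbmap_ltr; exists (trans (sgval t) 1%g r).
  - by rewrite orbmap_rtr; exists (trans 1%g (sgval t) r).
pose Q := [set M | orb_submodule M /\ ~ maxideal_mul M 1].
have QN : Q (range orbmap) by split=> //; exact: maxideal_mul_range.
have [C C0 CQ Ctot|M [NM [oM nJ] Mmax]] := zorn_above QN.
  split; last by move=> /(maxideal_mul_chain C0 Ctot)[M /CQ[]].
  split.
  - by apply: subspace_chain => // M /CQ[[]].
  - by move=> f [M /CQ[[_ MB _ _ _] _]]; exact: MB.
  - by move=> r f [M CM Mf]; exists M => //; have [[_ _ Mmul _ _] _] := CQ _ CM; exact: Mmul.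
  - by move=> s f Ss [M CM Mf]; exists M => //; have [[_ _ _ lM _] _] := CQ _ CM; exact: lM.
  - by move=> s f Ss [M CM Mf]; exists M => //; have [[_ _ _ _ rM] _] := CQ _ CM; exact: rM.
suff BM : coordHH `<=` M by move=> /(maxideal_mulS BM).
move=> f Bf; apply: contrapT => nMf; have [sM MB Mmul lM rM] := oM.
have M1 : M 1 by apply: NM; exists 1.
have pB (S : set (F -> F)) : (forall s, S s -> forall a b, coordHH (s (tens a b))) ->
    (forall s, S s -> linear s) -> preserves S coordHH.
  move=> St Sl s f' Ss; move: f'; apply: (@coordHH_ind (s @^-1` coordHH)) => [|a b].
    have sB := coordHH_subspace; have ls := Sl _ Ss.
    split=> [|c u v Bu Bv]; first by rewrite /= (linearop0 ls); exact: sB.1.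
    by rewrite /= ls; exact: sB.2.
  exact: St.
have [|||b [Bb nMb lb rb]] := fixed_vector2 k0 coordHH_subspace sM ltr_unipotent rtr_unipotent
  _ _ lM rM _ Bf nMf.
- by apply: pB => _ [t _ <-]; [move=> a b; rewrite ltr_tens; exact: coordHH_tens | exact: ltr_linear].
- by apply: pB => _ [t _ <-]; [move=> a b; rewrite rtr_tens; exact: coordHH_tens | exact: rtr_linear].
- by move=> _ _ [t _ <-] [t' _ <-].
have QM' := maxideal_mul_extend oM M1 nMb Bb lb rb nJ.
apply: nMb; apply: (Mmax _ _ QM') => [m Mm|].
  by exists m, 0; rewrite (linearop0 orbmap_linear) mul0r addr0.
by exists 0, 1; rewrite orbmap1 mul1r add0r; split=> //; exact: sM.1.
Qed.

(** A common zero [(h, h')] of the pullbacks of [m_x] satisfies [h g h' = x]. *)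
Lemma orbit_closed : (Z : set G) x.
Proof.
have sB := coordHH_subspace; have [e Be] := coordHH_countable.
have iJ : ideal_of coordHH (maxideal_mul coordHH).
  split=> [||f u Bf]; first exact: maxideal_mul_subspace.
    by apply: maxideal_mul_ind => // r m _ Bm; apply: coordHHM => //; exact: orbmap_coordHH.
  move: u; apply: (@maxideal_mul_ind _ [set u | maxideal_mul coordHH (f * u)]) => [|r m rx Bm].
    have sJ := maxideal_mul_subspace coordHH.
    split=> [|c u v Ju Jv] /=; first by rewrite mulr0; exact: sJ.1.
    by rewrite linear_fct_mul; exact: sJ.2.
  by rewrite /= mulrCA; apply: maxideal_mul_mem => //; exact: coordHHM.
have [chi chiP chi0] :=
  proper_ideal_character kunc sB coordHH1 coordHHM Be iJ maxideal_mul_coordHH.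
have [y yE] := coordHH_character chiP.
have yx (r : A) : r x = 0 -> r (sgval y.1 * g * sgval y.2)%g = 0.
  move=> rx; rewrite -[LHS]/(orbmap r y) -yE; last exact: orbmap_coordHH.
  by apply: chi0; rewrite -[orbmap r]mulr1; apply: maxideal_mul_mem => //; exact: coordHH1.
have <- : (sgval y.1 * g * sgval y.2)%g = x.
  apply: (@coordf_inj k G); apply/funext => i; apply/eqP; rewrite -subr_eq0; apply/eqP.
  have := yx (CoordAlg (coordf_regular i) - coordf x i *: 1).
  by rewrite !subE !scaleE !oneE !mulr1; apply; rewrite /regfun /= subrr.
apply: double_coset_stable => //; exact/subgroup_predP/(valP _).
Qed.

End Orbit.
End ClosedOrbits.

(** * Invariant functions in the twisted algebra *)

Section Contraction.
Variables (k : closedFieldType) (G : affGroup k) (E : lmodType k) (W : set E).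
Hypothesis sW : subspace W.
Local Notation A := (coordAlg G).

(** On a finite-dimensional subspace of [O(G)] every linear form is a combination of
    evaluations.  The proof eliminates one term: where [a l != 0], the vector [e] is
    modulo [W] a combination of the others. *)
Lemma contract_mod (theta : A -> k) : scalar theta -> forall s : seq (A * E),
  (forall g, W (\sum_(u <- s) u.1 g *: u.2)) -> W (\sum_(u <- s) theta u.1 *: u.2).
Proof.
move=> lt s; have [n] := ubnP (size s); elim: n s => // n IHn [|[a e] s] /=.
  by move=> _ _; rewrite big_nil; exact: subspace0.
rewrite ltnS => sn Ws; have [a0|a0] := eqVneq a 0.
  rewrite big_cons /= a0 (Defs.scalar0 lt) scale0r add0r; apply: IHn => // g.
  by have := Ws g; rewrite big_cons /= a0 zeroE scale0r add0r.
have [l al] : exists l, a l != 0.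
  apply: contrapT => /forallNP al; move/eqP: a0; apply; apply: coordAlg_eqP => l.
  by apply/eqP; apply: contrapT => /negP; exact: al.
pose d (u : A * E) := u.1 l / a l.
have We : W (e + \sum_(u <- s) d u *: u.2).
  have := subspaceZ (a l)^-1 sW (Ws l); rewrite big_cons /= scalerDr scalerA mulVf // scale1r.
  congr (W (_ + _)); rewrite scaler_sumr; apply: eq_bigr => u _.
  by rewrite scalerA mulrC.
have shift (x : A -> k) : scalar x -> \sum_(u <- (a, e) :: s) x u.1 *: u.2 =
    \sum_(u <- [seq (u.1 - d u *: a, u.2) | u <- s]) x u.1 *: u.2
      + x a *: (e + \sum_(u <- s) d u *: u.2).
  move=> lx; rewrite big_cons big_map /= scalerDr addrCA; congr (_ + _).
  rewrite scaler_sumr -big_split; apply: eq_bigr => u _.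
  by rewrite /= (Defs.scalarB lx) (Defs.scalarZ lx) scalerBl scalerA [x a * _]mulrC subrK.
rewrite shift //; apply: (subspaceD sW); last exact: subspaceZ.
apply: IHn => [|g]; first by rewrite size_map.
rewrite -[X in W X](addrK (a g *: (e + \sum_(u <- s) d u *: u.2))).
by rewrite -(shift _ (scalar_ev g)); apply: (subspaceB sW) => //; exact: subspaceZ.
Qed.

Lemma contract2_mod (theta theta' : A -> k) : scalar theta -> scalar theta' ->
  forall s : seq (A * A * E),
  (forall g h, W (\sum_(u <- s) (u.1.1 g * u.1.2 h) *: u.2)) ->
  W (\sum_(u <- s) (theta u.1.1 * theta' u.1.2) *: u.2).
Proof.
move=> lt lt' s Ws.
have := contract_mod lt (s := [seq (u.1.1, theta' u.1.2 *: u.2) | u <- s]).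
rewrite big_map /=; under eq_bigr do rewrite scalerA; apply=> g.
have := contract_mod lt' (s := [seq (u.1.2, regfun u.1.1 g *: u.2) | u <- s]).
rewrite !big_map /=; under eq_bigr do rewrite scalerA mulrC -scalerA; apply=> h.
by rewrite big_map /=; under eq_bigr do rewrite scalerA mulrC.
Qed.

End Contraction.

Section TwistedProduct.
Variables (k : closedFieldType) (G : affGroup k) (J : hopf_cocycle G) (H : closed_subgroup G).
Hypothesis supJ : is_support H J.
Local Notation A := (coordAlg G).
Local Notation HG := (subgroup_affGroup H).
Variable I : set A.
Hypothesis stI : stable_ideal H I.

(** The sum of the [theta(a_1) theta'(a_3) a_2]: the twisted product of [a] and [b] is
    a combination of such terms, multiplied by the [b_2]. *)
Definition contract (theta theta' : coordAlg HG -> k) (a : A) : A :=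
  \sum_(u <- comul3 a) (theta (res H u.1.1) * theta' (res H u.2)) *: u.1.2.

(** The linear forms only see the translates of [a] by [H x H]; the added term
    [(1, 1, - a)] turns these translates into elements of [I]. *)
Lemma contract_invariant theta theta' a : scalar theta -> scalar theta' ->
  invariant_mod H I a -> I (contract theta theta' a - (theta 1 * theta' 1) *: a).
Proof.
move=> lt lt' ia; have [[sI _] _] := stI.
have := contract2_mod sI lt lt'
  (s := (1, 1, - a) :: [seq (res H u.1.1, res H u.2, u.1.2) | u <- comul3 a]).
rewrite big_cons big_map /= scalerN addrC; apply=> g h.
rewrite big_cons big_map /= !oneE mulr1 scale1r addrC.
by apply: ia; exact/subgroup_predP/(valP _).
Qed.

(** Functions that are [H x H]-invariant modulo [I] multiply modulo [I] in the
    twisted algebra as in [O(G)]: the cocycle only sees their restrictions to [H]. *)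
Lemma tmul_invariantl f b : invariant_mod H I f -> I (tmul J f b - f * b).
Proof.
move=> fI; have [[sI mI] _] := stI; have [JH [_ JJH]] := supJ.
have [[Jl Jr] [Jil Jir]] := (cocycle_bilinear JH, cocycle_inv_bilinear JH).
rewrite -{2}(trans1 b) /trans mulr_sumr /tmul exchange_big -sumrB.
apply: subspace_sum => // v _.
pose t := cocycle_inv JH ^~ (res H v.1.1); pose t' := JH ^~ (res H v.2).
have -> : \sum_(u <- comul3 f) (cocycle_inv J u.1.1 v.1.1 * J u.2 v.2) *: (u.1.2 * v.1.2) =
    v.1.2 * contract t t' f.
  rewrite mulr_sumr; apply: eq_bigr => u _.
  by rewrite (support_inv JJH) JJH -scalerAr [u.1.2 * _]mulrC.
rewrite [X in _ - X](_ : _ = v.1.2 * ((t 1 * t' 1) *: f)); last first.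
  by rewrite /t /t' cocycle_inv_1l cocycle_1l -!scalerAr [f * _]mulrC.
by rewrite -mulrBr; apply: mI; apply: contract_invariant; [exact: Jil | exact: Jl |].
Qed.

Lemma tmul_invariantr f b : invariant_mod H I f -> I (tmul J b f - b * f).
Proof.
move=> fI; have [[sI mI] _] := stI; have [JH [_ JJH]] := supJ.
have [[Jl Jr] [Jil Jir]] := (cocycle_bilinear JH, cocycle_inv_bilinear JH).
rewrite -{2}(trans1 b) /trans mulr_suml /tmul -sumrB.
apply: subspace_sum => // v _.
pose t := cocycle_inv JH (res H v.1.1); pose t' := JH (res H v.2).
have -> : \sum_(u <- comul3 f) (cocycle_inv J v.1.1 u.1.1 * J v.2 u.2) *: (v.1.2 * u.1.2) =
    v.1.2 * contract t t' f.
  rewrite mulr_sumr; apply: eq_bigr => u _.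
  by rewrite (support_inv JJH) JJH -scalerAr.
rewrite [X in _ - X](_ : _ = v.1.2 * ((t 1 * t' 1) *: f)); last first.
  by rewrite /t /t' cocycle_inv_1r cocycle_1r -scalerAr -scalerAl.
by rewrite -mulrBr; apply: mI; apply: contract_invariant; [exact: Jir | exact: Jr |].
Qed.

End TwistedProduct.

(** * Irreducible representations *)

Lemma factors_throughP (k : pzRingType) (A : algType k) (V : lmodType k)
    (rho : representation A V) (I : two_sided_ideal A) :
  factors_through rho I <-> forall a v, (I : set A) a -> rho a v = 0.
Proof.
split=> [[sigma sE] a v Ia|Iann].
  rewrite sE; have -> : quot_proj I a = 0.
    by rewrite -(quot_proj0 I); apply/quot_projP; rewrite subr0.
  exact: (linearop0 (act_linearl sigma v)).
have rhoE a a' v : (I : set A) (a - a') -> rho a v = rho a' v.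
  move=> Iaa'; have := Iann _ v Iaa'; rewrite (linearopB (act_linearl rho v)).
  by move/eqP; rewrite subr_eq0 => /eqP.
pose sg (x : quotient_alg I) v := rho (quot_repr x) v.
have sgE a v : sg (quot_proj I a) v = rho a v.
  by apply: rhoE; apply/quot_projP; rewrite quot_reprK.
have sgl v : linear (sg^~ v).
  move=> c; elim/quot_ind=> a; elim/quot_ind=> b.
  rewrite -[c *: _]/(quot_scale c _) quot_projZ -quot_projD !sgE.
  exact: act_linearl.
have sg1 v : sg 1 v = v by rewrite -[1]/(quot_proj I 1) sgE act1.
have sgM x y v : sg (x * y) v = sg x (sg y v).
  elim/quot_ind: x => a; elim/quot_ind: y => b.
  by rewrite -[_ * _]/(quot_mul _ _) quot_projM !sgE actM.
exists (Representation sgl (fun x => act_linearr rho (quot_repr x)) sg1 sgM) => a v.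
exact: (esym (sgE a v)).
Qed.

Section Annihilator.
Variables (k : closedFieldType) (G : affGroup k) (J : hopf_cocycle G) (H : closed_subgroup G).
Hypothesis supJ : is_support H J.
Hypotheses (kunc : ~ countable [set: k]) (k0 : [pchar k] =i pred0).
Hypothesis unipG : unipotent G.
Variables (V : lmodType k) (rho : representation (twisted J) V).
Hypothesis irr : irreducible rho.
Local Notation A := (coordAlg G).

(** The largest stable ideal of [O(G)] that annihilates [V], described by what the
    ideal and the stability conditions require of each of its elements. *)
Definition stable_annihilator : set A := [set a | forall h h' (b : A) v,
  (H : set G) h -> (H : set G) h' -> rho (b * trans h h' a : A) v = 0].

Let linrho v : linear (fun a : A => rho a v).
Proof. by move=> c a b; exact: (act_linearl rho v). Qed.

Lemma stable_annihilator_ann a v : stable_annihilator a -> rho a v = 0.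
Proof. by move=> /(_ 1%g 1%g 1 v (subgroup1 H) (subgroup1 H)); rewrite trans1 mul1r. Qed.

Lemma stable_annihilator_max (I : set A) : stable_ideal H I ->
  (forall a v, I a -> rho a v = 0) -> I `<=` stable_annihilator.
Proof.
by move=> [[_ mI] stI] Iann a Ia h h' b v Hh Hh'; apply: Iann; apply: mI; exact: stI.
Qed.

Lemma stable_annihilator_stable : stable_ideal H stable_annihilator.
Proof.
split; first split.
- split=> [h h' b v _ _|c a a' Ia Ia' h h' b v Hh Hh'].
    by rewrite (linearop0 (trans_linear h h')) mulr0 (linearop0 (linrho v)).
  by rewrite trans_linear mulrDr -scalerAr (linrho v) Ia // Ia' // scaler0 addr0.
- by move=> a a' Ia' h h' b v Hh Hh'; rewrite transM mulrA; exact: Ia'.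
- move=> g g' a Hg Hg' Ia h h' b v Hh Hh'; rewrite trans_trans.
  by apply: Ia; exact: subgroupM.
Qed.

Lemma stable_annihilator_proper : ~ stable_annihilator 1.
Proof.
move=> I1; have [[v v0] _] := irr; move/eqP: v0; apply.
by rewrite -(act1 rho v); exact: stable_annihilator_ann.
Qed.

(** Schur's lemma in Dixmier's form: [w] is central modulo the annihilator, so it
    acts by an endomorphism [T]; since [V] has countable dimension, some [T - c] is
    not onto or not injective, and as its image and kernel are submodules, [T = c]. *)
Lemma invariant_acts_by_scalar w : invariant_mod H stable_annihilator w ->
  exists c, forall v, rho w v = c *: v.
Proof.
move=> wI; have stI := stable_annihilator_stable.
have rhoE (a b : A) v : stable_annihilator (a - b) -> rho a v = rho b v.
  move=> /(@stable_annihilator_ann _ v); rewrite (linearopB (linrho v)).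
  by move/eqP; rewrite subr_eq0 => /eqP.
have wC (b : A) v : rho w (rho b v) = rho b (rho w v).
  rewrite -!actM (rhoE _ _ _ (tmul_invariantl supJ stI b wI)).
  by rewrite mulrC -(rhoE _ _ _ (tmul_invariantr supJ stI b wI)).
have [[v0 v0n] simple] := irr.
have gen v : exists a : A, v = rho a v0.
  have [|||S0|ST] := simple [set v | exists a : A, v = rho a v0].
  - by exists 0; rewrite (linearop0 (linrho v0)).
  - by move=> c _ _ [a ->] [b ->]; exists (c *: a + b); rewrite (linrho v0).
  - by move=> b _ [a ->]; exists (tmul J b a); rewrite -actM.
  - have : [set v | exists a : A, v = rho a v0] v0 by exists 1; rewrite act1.
    by rewrite S0 => /= v00; rewrite v00 eqxx in v0n.
  - by have : [set v | exists a : A, v = rho a v0] v by rewrite ST.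
have lw : linear (rho w) by exact: act_linearr.
have sT : subspace [set: V] by split.
have s0 : subspace [set 0 : V] by split=> // c _ _ -> ->; rewrite scaler0 addr0.
have spanV v : [set: V] v -> countable_span (fun n => rho (@monfun k G n) v0) v.
  move=> _; have [a ->] := gen v; have [n [c ->]] := coordAlg_countable a.
  by exists n, c; rewrite (linearop_comb (linrho v0)).
have nW0 : ~ [set 0 : V] v0 by move=> /= v00; rewrite v00 eqxx in v0n.
have [//|v ->|[c nc]|[c [v [_ v1 wv]]]] := spectrum_mod kunc lw sT s0 _ _ spanV I nW0.
- exact: (linearop0 lw).
- exists c => v; have [|||S0|ST] := simple [set u | exists u', u = rho w u' - c *: u'].
  + by exists 0; rewrite (linearop0 lw) scaler0 subr0.
  + move=> d _ _ [u ->] [u' ->]; exists (d *: u + u').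
    by rewrite lw scalerBr scalerDr opprD addrACA !scalerA mulrC.
  + move=> b _ [u ->]; exists (rho b u).
    have lb : linear (rho b) by exact: act_linearr.
    by rewrite (linearopB lb) wC; congr (_ - _); rewrite (linearopZ lb).
  + have : [set u | exists u', u = rho w u' - c *: u'] (rho w v - c *: v) by exists v.
    by rewrite S0 => /eqP; rewrite subr_eq0 => /eqP.
  + have : [set u | exists u', u = rho w u' - c *: u'] v0 by rewrite ST.
    by move=> [u v0E]; case: (nc u I); rewrite v0E /= subrr.
- exists c => u; have [|||S0|ST] := simple [set u | rho w u = c *: u].
  + by rewrite /= (linearop0 lw) scaler0.
  + by move=> d x y /= xE yE; rewrite lw xE yE scalerDr !scalerA mulrC.
  + move=> b x /= xE; have lb : linear (rho b) by exact: act_linearr.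
    by rewrite wC xE (linearopZ lb).
  + case: v1; have : [set u | rho w u = c *: u] v by apply/eqP; rewrite -subr_eq0; apply/eqP.
    by rewrite S0.
  + by have : [set u | rho w u = c *: u] u by rewrite ST.
Qed.

(** Let [g] be a zero of the ideal.  A function [w] that vanishes on [H g H] and is
    invariant modulo the ideal acts by a scalar [c], and [w - c] is again in the ideal
    because it is invariant modulo it and kills [V]; at [g] this gives [c = 0]. *)
Lemma stable_annihilator_orbit : exists Z : double_coset H, stable_annihilator = vanishing Z.
Proof.
have stI := stable_annihilator_stable; have [[sI mI] tI] := stI.
have [g gI] := coord_ideal_zero kunc stI.1 stable_annihilator_proper.
exists (DoubleCoset (ex_intro _ g erefl)); set Z := DoubleCoset _.
have Zg : (Z : set G) g.
  exists 1%g; first exact: subgroup1.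
  by exists 1%g; [exact: subgroup1 | rewrite mul1g mulg1].
have [[sZ mZ] tZ] := vanishing_stable_ideal Z.
apply/seteqP; split=> [a Ia z|f Zf].
  rewrite (double_coset_rep Zg) => -[h Hh [h' Hh' <-]].
  by rewrite -transE; apply/gI/tI.
apply: contrapT => nIf.
have [w [Zw nIw wI]] := exists_invariant_mod k0 unipG sZ sI tZ tI Zf nIf.
have [c wc] := invariant_acts_by_scalar wI.
have Iwc : stable_annihilator (w - c *: 1).
  have wcI : invariant_mod H stable_annihilator (w - c *: 1).
    move=> h h' Hh Hh'; have -> : trans h h' (w - c *: 1) - (w - c *: 1) = trans h h' w - w.
      by apply: coordAlg_eqP => x; rewrite !(subE, transE, scaleE, oneE); ring.
    exact: wI.
  move=> h h' b v Hh Hh'.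
  have E1 : stable_annihilator (b * trans h h' (w - c *: 1) - tmul J b (w - c *: 1)).
    apply: (subspace_trans sI (v := b * (w - c *: 1))).
      by rewrite -mulrBr; apply: mI; exact: wcI.
    rewrite -opprB; apply: (subspaceN sI).
    exact: (tmul_invariantr supJ stI b wcI).
  have := stable_annihilator_ann v E1; rewrite (linearopB (linrho v)).
  have -> : rho (tmul J b (w - c *: 1)) v = rho b (rho (w - c *: 1 : A) v) by rewrite -actM.
  have -> : rho (w - c *: 1 : A) v = 0.
    rewrite (linearopB (linrho v)) wc (linearopZ (linrho v)).
    by rewrite [rho 1 v](act1 rho v) subrr.
  by rewrite (linearop0 (act_linearr rho b)) subr0.
have := gI _ Iwc; rewrite subE Zw // scaleE oneE mulr1 sub0r => /eqP; rewrite oppr_eq0 => /eqP c0.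
by apply: nIw; rewrite c0 scale0r subr0 in Iwc.
Qed.

(** If [vanishing Z'] annihilates [V], it is contained in the largest such ideal,
    [vanishing Z]; so [Z] meets the closed set [Z']. *)
Lemma factors_unique_orbit :
  exists! Z : double_coset H, factors_through rho (vanishing_ideal supJ Z).
Proof.
have [Z ZE] := stable_annihilator_orbit; exists Z; split=> [|Z'].
  by apply/factors_throughP => a v Za; apply: stable_annihilator_ann; rewrite ZE.
move=> /factors_throughP Z'ann.
have Z'Z : vanishing Z' `<=` vanishing Z.
  by rewrite -ZE; apply: stable_annihilator_max => //; exact: vanishing_stable_ideal.
have [x Zx] := double_coset_inhabited Z; have [g Z'g] := double_coset_inhabited Z'.
apply: (double_coset_meet Zx).
by apply: (orbit_closed kunc k0 unipG Z'g) => r /Z'Z; exact.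
Qed.

End Annihilator.

Lemma complex_char0 (R : realType) : [pchar R[i]] =i pred0.
Proof. exact: pchar_num. Qed.

Theorem theorem5p1 (R : realType) (G : affGroup R[i]) (unipG : unipotent G)
  (J : hopf_cocycle G) (H : closed_subgroup G) (suppJ : is_support H J)
  (V : lmodType R[i]) (rho : representation (twisted J) V)
  (irr : irreducible rho) :
  exists! Z : double_coset H, factors_through rho (vanishing_ideal suppJ Z).
Proof.
exact: (factors_unique_orbit suppJ (@complex_uncountable R) (@complex_char0 R) unipG irr).
Qed.
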